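(* Let $U=(U(n))_{n\ge 0}$ be a positional numeration system for which there is an adder, and let $\mathbf{x}$ be a $U$-automatic sequence. Then the reflection complexity $(r_{\mathbf{x}}(n))_{n\ge 0}$ is a $U$-regular sequence. Furthermore, a linear representation for $(r_{\mathbf{x}}(n))_{n\ge 0}$ is computable from a DFAO generating $\mathbf{x}$.
   Context: A positional numeration system is an increasing integer sequence $U=(U(n))_{n\ge0}$ with $U(0)=1$; the $U$-representation $\mathrm{rep}_U(n)=c(t)\cdots c(0)$ of $n$ is obtained greedily so that $n=\sum_i c(i)U(i)$ (with $\mathrm{rep}_U(0)=\varepsilon$, and a nonzero leading digit otherwise). $U$ has an adder if the set of triples $(a,b,c)$ with $a+b=c$ is recognizable by a finite automaton reading (suitably padded) $U$-representations in parallel. A sequence $\mathbf{x}$ is $U$-automatic if there is a deterministic finite automaton with output (DFAO) $\mathcal{A}$ such that $\mathbf{x}(n)=\mathcal{A}(\mathrm{rep}_U(n))$ for all $n\ge0$. An integer sequence $s$ is $U$-regular if there exist $d\ge1$, a row vector $\lambda$, a column vector $\gamma$ and a monoid morphism $\mu$ from digit words to $d\times d$ matrices (a linear representation) with $s(n)=\lambda\,\mu(\mathrm{rep}_U(n))\,\gamma$ for all $n$. A factor of a sequence is a finite contiguous block; the reversal of $u=u(1)\cdots u(m)$ is $u^R=u(m)\cdots u(1)$; $r_{\mathbf{x}}(n)$ is the number of distinct length-$n$ factors of $\mathbf{x}$ up to the equivalence $u\sim v \iff v\in\{u,u^R\}$. *)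

(* Defs.v *)
From mathcomp Require Import all_boot all_order all_algebra.
From mathcomp Require Import boolp.

Set Implicit Arguments.
Unset Strict Implicit.
Unset Printing Implicit Defensive.

Definition numeration_system (U : nat -> nat) : Prop :=
  U 0 = 1 /\ {homo U : m n / m < n}.

(* Greedy digits of [n] at the positions [t - 1], ..., [0]. *)
Fixpoint greedy (U : nat -> nat) (t n : nat) : seq nat :=
  if t is s.+1 then n %/ U s :: greedy U s (n %% U s) else [::].

(* The length of [rep U n] is the least [t] such that [n < U t]; it is at most
   [n] because [n < U n] in a numeration system. Words are written with the
   most significant digit first. *)
Definition rep (U : nat -> nat) (n : nat) : seq nat :=
  greedy U (find (fun t => n < U t) (iota 0 n.+1)) n.

Record dfao (A : finType) (T : Type) := Dfao {
  dfao_states : nat;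
  dfao_init : 'I_dfao_states;
  dfao_trans : 'I_dfao_states -> A -> 'I_dfao_states;
  dfao_out : 'I_dfao_states -> T
}.

Definition run (A : finType) (T : Type) (M : dfao A T) (w : seq A) : T :=
  dfao_out (foldl (@dfao_trans A T M) (dfao_init M) w).

Definition digits (k : nat) (w : seq 'I_k) : seq nat := [seq val c | c <- w].

Definition digits3 (k : nat) (w : seq ('I_k * 'I_k * 'I_k)) :
    seq (nat * nat * nat) :=
  [seq (val c.1.1, val c.1.2, val c.2) | c <- w].

Definition pad (t : nat) (w : seq nat) : seq nat := nseq (t - size w) 0 ++ w.

Definition pad3 (u v w : seq nat) : seq (nat * nat * nat) :=
  let t := maxn (maxn (size u) (size v)) (size w) in
  zip (zip (pad t u) (pad t v)) (pad t w).

(* A deterministic automaton over a finite alphabet of triples of digits accepts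
   exactly the words [pad3 (rep U a) (rep U b) (rep U c)] with [a + b = c].
   As [w] ranges over all words of triples of integers, this includes the fact
   that the digits occurring in [U]-representations are bounded by [k]. *)
Definition has_adder (U : nat -> nat) : Prop :=
  exists (k : nat) (M : dfao ('I_k * 'I_k * 'I_k)%type bool),
  forall w : seq (nat * nat * nat),
    (exists2 w', digits3 w' = w & run M w') <->
    (exists a b c : nat, a + b = c /\ w = pad3 (rep U a) (rep U b) (rep U c)).

Definition generates (U : nat -> nat) (k : nat) (T : Type) (M : dfao 'I_k T)
    (x : nat -> T) : Prop :=
  forall n, exists2 w, digits w = rep U n & x n = run M w.

Definition automatic (U : nat -> nat) (T : Type) (x : nat -> T) : Prop :=
  exists (k : nat) (M : dfao 'I_k T), generates U M x.

(* The morphism into matrices is given by its values on the digits. *)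
Record linrep (k : nat) := Linrep {
  lr_dim : nat;
  lr_dim_gt0 : 0 < lr_dim;
  lr_row : 'rV[int]_lr_dim;
  lr_mx : 'I_k -> 'M[int]_lr_dim;
  lr_col : 'cV[int]_lr_dim
}.

Definition lr_morph (k : nat) (L : linrep k) (w : seq 'I_k) :
    'M[int]_(lr_dim L) :=
  \big[mulmx/1%:M%R]_(c <- w) lr_mx L c.

Definition lr_value (k : nat) (L : linrep k) (w : seq 'I_k) : int :=
  (lr_row L *m lr_morph L w *m lr_col L)%R ord0 ord0.

Definition represents (U : nat -> nat) (k : nat) (L : linrep k)
    (s : nat -> int) : Prop :=
  forall n, exists2 w, digits w = rep U n & s n = lr_value L w.

Definition regular (U : nat -> nat) (s : nat -> int) : Prop :=
  exists (k : nat) (L : linrep k), represents U L s.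

Section Reflection.
Variables (T : finType) (x : nat -> T).

Definition factor (n i : nat) : n.-tuple T := [tuple x (i + j) | j < n].

Definition factors (n : nat) : {set n.-tuple T} :=
  [set u | `[< exists i, u = factor n i >]].

Definition refl_eqv (n : nat) : rel (n.-tuple T) :=
  fun u v => (v == u) || (v == [tuple of rev u]).

Definition reflection_complexity (n : nat) : nat :=
  #|equivalence_partition (@refl_eqv n) (factors n)|.

End Reflection.

(* The total recursive functions: the least class of functions of several
   natural numbers that contains the constant 0, the successor and the
   projections, and is closed under composition, primitive recursion and
   minimization of functions that have a zero for all values of the parameters. *)
Inductive recursive : forall n : nat, (n.-tuple nat -> nat) -> Prop :=
| Rec_zero n : recursive (fun _ : n.-tuple nat => 0)
| Rec_succ : recursive (fun v : 1.-tuple nat => (thead v).+1)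
| Rec_proj n (i : 'I_n) : recursive (fun v : n.-tuple nat => tnth v i)
| Rec_comp n m (f : m.-tuple nat -> nat) (g : 'I_m -> n.-tuple nat -> nat) :
    recursive f -> (forall i, recursive (g i)) ->
    recursive (fun v : n.-tuple nat => f [tuple g i v | i < m])
| Rec_prim n (f : n.-tuple nat -> nat) (g : n.+2.-tuple nat -> nat)
    (h : n.+1.-tuple nat -> nat) :
    recursive f -> recursive g ->
    (forall v, h (cons_tuple 0 v) = f v) ->
    (forall y v, h (cons_tuple y.+1 v) =
                 g (cons_tuple y (cons_tuple (h (cons_tuple y v)) v))) ->
    recursive h
| Rec_min n (f : n.+1.-tuple nat -> nat) (h : n.-tuple nat -> nat) :
    recursive f ->
    (forall v, f (cons_tuple (h v) v) = 0) ->
    (forall v y, y < h v -> f (cons_tuple y v) <> 0) ->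
    recursive h.

Definition computable (F : nat -> nat) : Prop :=
  recursive (fun v : 1.-tuple nat => F (thead v)).

(* Automata and linear representations are written as lists of natural numbers,
   which are then turned into natural numbers by the bijection [CodeSeq.code].
   Output letters are coded by their rank in the alphabet. *)
Definition dfao_code (k : nat) (T : finType) (M : dfao 'I_k T) : nat :=
  CodeSeq.code
    ([:: k; dfao_states M; val (dfao_init M)]
     ++ [seq val (dfao_trans q c) | q <- enum 'I_(dfao_states M),
                                    c <- enum 'I_k]
     ++ [seq val (enum_rank (dfao_out q)) | q <- enum 'I_(dfao_states M)]).

Definition int_code (z : int) : nat :=
  match z with Posz n => n.*2 | Negz n => n.*2.+1 end.

Definition mx_code (m n : nat) (A : 'M[int]_(m, n)) : seq nat :=
  [seq int_code (A i j) | i <- enum 'I_m, j <- enum 'I_n].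

Definition linrep_code (k : nat) (L : linrep k) : nat :=
  CodeSeq.code
    ([:: k; lr_dim L]
     ++ mx_code (lr_row L)
     ++ flatten [seq mx_code (lr_mx L c) | c <- enum 'I_k]
     ++ mx_code (lr_col L)).

(* Main.v *)
Require Import Defs.
From mathcomp Require Import all_boot all_order all_algebra.
From mathcomp Require Import boolp zify.

(** The reflection complexity r(n) counts the positions i at which a factor of
    length n occurs for the first time, up to reversal. By means of the adder,
    the set of these pairs (n, i) is defined by a first-order formula, hence it
    is recognized by an automaton that reads n and i in parallel; a pumping
    argument bounds the length of i by that of n plus the number D of states,
    so that counting the paths labelled by a given n yields a linear
    representation of dimension D.

    As D is an explicit function of the number of states of the given automaton,
    this automaton need not be built: it suffices to search, among the finitely
    many transition tables with D states, for one that agrees with the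
    definition of first occurrences on all pairs of words of length less than
    D ^ 2. By pigeonhole it agrees on all words. This search is primitive
    recursive since U is: U(t) is the number of valid words of length t, where
    w is valid when w + 0 = w is accepted by the adder. *)

(** The program depends on [U]: the adder is a finite object fixed beforehand, so its tables enter
    as numerical constants, and only the DFAO is an input. Performing products, complements and
    subset constructions on coded automata would require a verified recursive implementation of each
    of them. The search only needs that some automaton with exactly [D] states exists, which is why
    [recog] records the number of states next to the language. A first occurrence i may have a
    longer representation than n, so pairing words of the length of n alone would miss some of them.
    Therefore n is read behind [D] additional zeros; the letters of i facing these zeros are summed
    out in advance and give the row vector, so that the matrices only see the digits of n. *)

Set Implicit Arguments.
Unset Strict Implicit.
Unset Printing Implicit Defensive.

(** * Recursive functions *)

(* [f] is recursive as a function of an environment, in which the de Bruijn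
   index [i] denotes [nth 0 v i]; a binder pushes its variable in front. *)
Definition RE (f : seq nat -> nat) : Prop :=
  forall n, recursive (fun v : n.-tuple nat => f v).

Lemma eq_recursive n (f g : n.-tuple nat -> nat) :
  f =1 g -> recursive f -> recursive g.
Proof. by move=> /funext ->. Qed.

Lemma RE_nth i : RE (fun v => nth 0 v i).
Proof.
move=> n; have [lt_in|le_ni] := ltnP i n.
  by apply: eq_recursive (Rec_proj (Ordinal lt_in)) => v; rewrite (tnth_nth 0).
by apply: eq_recursive (Rec_zero n) => v; rewrite nth_default ?size_tuple.
Qed.

Lemma RE_comp (f : seq nat -> nat) (gs : seq (seq nat -> nat)) :
  RE f -> (forall i, RE (nth (fun=> 0) gs i)) ->
  RE (fun v => f [seq g v | g <- gs]).
Proof.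
move=> Hf Hg n.
apply: eq_recursive (Rec_comp (Hf (size gs)) (fun i : 'I_(size gs) => Hg i n)) => v.
congr f; apply: (@eq_from_nth _ 0); first by rewrite size_tuple size_map.
move=> i; rewrite size_tuple => lt_i.
by rewrite -(tnth_nth 0 _ (Ordinal lt_i)) tnth_mktuple (nth_map (fun=> 0)).
Qed.

Lemma RE_ext f g : f =1 g -> RE f -> RE g.
Proof. by move=> /funext ->. Qed.

Lemma RE_comp1 (f : nat -> nat) g :
  RE (fun v => f (nth 0 v 0)) -> RE g -> RE (fun v => f (g v)).
Proof.
move=> Hf Hg; apply: (RE_comp (gs := [:: g]) Hf) => -[|i] //=.
by rewrite nth_nil => n; apply: Rec_zero.
Qed.

Lemma RE_zero : RE (fun=> 0).
Proof. by move=> n; apply: Rec_zero. Qed.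

Lemma RE_comp2 (f : nat -> nat -> nat) g h :
  RE (fun v => f (nth 0 v 0) (nth 0 v 1)) -> RE g -> RE h ->
  RE (fun v => f (g v) (h v)).
Proof.
move=> Hf Hg Hh; apply: (RE_comp (gs := [:: g; h]) Hf) => -[|[|i]] //=.
by rewrite nth_nil; apply: RE_zero.
Qed.

Lemma RE_comp3 (f : nat -> nat -> nat -> nat) g h l :
  RE (fun v => f (nth 0 v 0) (nth 0 v 1) (nth 0 v 2)) -> RE g -> RE h -> RE l ->
  RE (fun v => f (g v) (h v) (l v)).
Proof.
move=> Hf Hg Hh Hl; apply: (RE_comp (gs := [:: g; h; l]) Hf) => -[|[|[|i]]] //=.
by rewrite nth_nil; apply: RE_zero.
Qed.

Lemma RE_comp4 (f : nat -> nat -> nat -> nat -> nat) g h l m :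
  RE (fun v => f (nth 0 v 0) (nth 0 v 1) (nth 0 v 2) (nth 0 v 3)) ->
  RE g -> RE h -> RE l -> RE m ->
  RE (fun v => f (g v) (h v) (l v) (m v)).
Proof.
move=> Hf Hg Hh Hl Hm.
apply: (RE_comp (gs := [:: g; h; l; m]) Hf) => -[|[|[|[|i]]]] //=.
by rewrite nth_nil; apply: RE_zero.
Qed.

Lemma RE_succ f : RE f -> RE (fun v => (f v).+1).
Proof.
move=> Hf n; apply: eq_recursive (Rec_comp Rec_succ (fun=> Hf n)) => v /=.
by rewrite /thead tnth_mktuple.
Qed.

Lemma RE_const c : RE (fun=> c).
Proof. by elim: c => [|c /RE_succ]; first exact: RE_zero. Qed.

Lemma RE_behead f : RE f -> RE (fun v => f (behead v)).
Proof.
move=> Hf [|n].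
  by apply: eq_recursive (RE_const (f [::]) 0) => v; rewrite tuple0.
apply: eq_recursive (Rec_comp (Hf n) (fun i => Rec_proj (lift ord0 i))) => v.
congr f; apply: (@eq_from_nth _ 0); first by rewrite size_behead !size_tuple.
move=> i; rewrite size_tuple => lt_in.
rewrite nth_behead -(tnth_nth 0 _ (Ordinal lt_in)) tnth_mktuple.
by rewrite (tnth_nth 0) lift0.
Qed.

Lemma RE_let F g : RE (fun v => F (nth 0 v 0) (behead v)) -> RE g ->
  RE (fun v => F (g v) v).
Proof.
move=> HF Hg n.
pose h (i : 'I_n.+1) (v : n.-tuple nat) := nth 0 (g v :: v) i.
have Hh i : recursive (h i).
  by rewrite /h; case: i => [[|i] lt_i] /=; [apply: Hg | apply: RE_nth].
apply: eq_recursive (Rec_comp (HF n.+1) Hh) => v.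
rewrite -[RHS]/((fun u => F (nth 0 u 0) (behead u)) (g v :: v)).
congr ((fun u => F (nth 0 u 0) (behead u)) _).
apply: (@eq_from_nth _ 0); first by rewrite size_tuple /= size_tuple.
move=> i; rewrite size_tuple => lt_i.
by rewrite -(tnth_nth 0 _ (Ordinal lt_i)) tnth_mktuple.
Qed.

Fixpoint prec (a : nat) (G : nat -> nat -> nat) (j : nat) : nat :=
  if j is i.+1 then G i (prec a G i) else a.

Lemma RE_prec a G b :
  RE a -> RE b ->
  RE (fun v => G (nth 0 v 0) (nth 0 v 1) (behead (behead v))) ->
  RE (fun v => prec (a v) (fun j y => G j y v) (b v)).
Proof.
move=> Ha Hb HG n.
pose h (v : n.+1.-tuple nat) :=
  prec (a (behead v)) (fun j y => G j y (behead v)) (nth 0 v 0).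
have Hh : recursive h by apply: Rec_prim (Ha n) (HG n.+2) _ _.
pose g (i : 'I_n.+1) (v : n.-tuple nat) := nth 0 (b v :: v) i.
have Hg i : recursive (g i).
  by rewrite /g; case: i => [[|i] lt_i] /=; [apply: Hb | apply: RE_nth].
apply: eq_recursive (Rec_comp Hh Hg) => v; rewrite /h.
have -> : [tuple g i v | i < n.+1] = b v :: v :> seq nat.
  apply: (@eq_from_nth _ 0); first by rewrite size_tuple /= size_tuple.
  move=> i; rewrite size_tuple => lt_i.
  by rewrite -(tnth_nth 0 _ (Ordinal lt_i)) tnth_mktuple.
by [].
Qed.

Ltac re_nth :=
  cbv beta; eapply RE_ext; [intro; rewrite ?nth_behead; reflexivity | apply RE_nth].

(** A hook, redefined when further functions are known to be recursive. The tactic [re] decomposes a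
    goal along such closure rules and leaves open the subgoals that no rule matches. *)
Ltac re_user := fail.

Ltac re :=
  cbv beta;
  lazymatch goal with
  | |- RE (fun v => nth 0 _ _) => re_nth
  | |- RE (fun _ => ?c) => apply: RE_const
  | |- RE _ => tryif re_step then re else idtac
  | _ => idtac
  end
with re_step := re_user.

Lemma RE_add f g : RE f -> RE g -> RE (fun v => f v + g v).
Proof.
apply: (RE_comp2 (f := addn)).
apply: (RE_ext (f := fun v => prec (nth 0 v 0) (fun _ y => y.+1) (nth 0 v 1))).
  by move=> v; elim: (nth 0 v 1) => [|i /= ->]; rewrite ?addn0 ?addnS.
by apply: (RE_prec (G := fun _ y _ => y.+1)); do ?apply: RE_succ; apply: RE_nth.
Qed.

Lemma RE_mul f g : RE f -> RE g -> RE (fun v => f v * g v).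
Proof.
apply: (RE_comp2 (f := muln)).
apply: (RE_ext (f := fun v => prec 0 (fun _ y => y + nth 0 v 0) (nth 0 v 1))).
  by move=> v; elim: (nth 0 v 1) => [|i /= ->]; rewrite ?muln0 ?mulnSr.
apply: (RE_prec (a := fun=> 0) (G := fun _ y v => y + nth 0 v 0)).
- exact: RE_const.
- exact: RE_nth.
- by apply: RE_add; re_nth.
Qed.

Lemma RE_pred f : RE f -> RE (fun v => (f v).-1).
Proof.
apply: (RE_comp1 (f := predn)).
apply: (RE_ext (f := fun v => prec 0 (fun j _ => j) (nth 0 v 0))).
  by move=> v; case: (nth 0 v 0).
apply: (RE_prec (a := fun=> 0) (G := fun j _ _ => j)); [exact: RE_const| |];
  exact: RE_nth.
Qed.

Lemma RE_sub f g : RE f -> RE g -> RE (fun v => f v - g v).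
Proof.
apply: (RE_comp2 (f := subn)).
apply: (RE_ext (f := fun v => prec (nth 0 v 0) (fun _ y => y.-1) (nth 0 v 1))).
  by move=> v; elim: (nth 0 v 1) => [|i /= ->]; rewrite ?subn0 ?subnS.
apply: (RE_prec (G := fun _ y _ => y.-1)); [exact: RE_nth..|].
by apply: RE_pred; exact: RE_nth.
Qed.

Lemma RE_exp f g : RE f -> RE g -> RE (fun v => f v ^ g v).
Proof.
apply: (RE_comp2 (f := expn)).
apply: (RE_ext (f := fun v => prec 1 (fun _ y => nth 0 v 0 * y) (nth 0 v 1))).
  by move=> v; elim: (nth 0 v 1) => [|i /= ->]; rewrite ?expn0 ?expnS.
apply: (RE_prec (a := fun=> 1) (G := fun _ y v => nth 0 v 0 * y)).
- exact: RE_const.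
- exact: RE_nth.
- by apply: RE_mul; re_nth.
Qed.

(** Removes the accumulator from the environment of a recursion step, for bodies that only know the
    index and the parameters. *)
Lemma RE_skip f : RE f -> RE (fun v => f (nth 0 v 0 :: behead (behead v))).
Proof.
move=> Hf [|[|n]].
- by apply: eq_recursive (RE_const (f [:: 0]) 0) => v; rewrite tuple0.
- by apply: eq_recursive (Hf 1) => -[[|c []]].
pose g (i : 'I_n.+1) (v : n.+2.-tuple nat) :=
  nth 0 (nth 0 v 0 :: behead (behead v)) i.
have Hg i : recursive (g i).
  rewrite /g; case: i => [[|i] lt_i] /=; first exact: RE_nth.
  have : RE (fun v => nth 0 v i.+2) by exact: RE_nth.
  by move/(_ n.+2); apply: eq_recursive => v; rewrite !nth_behead.
apply: eq_recursive (Rec_comp (Hf n.+1) Hg) => v.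
congr f; apply: (@eq_from_nth _ 0).
  by rewrite size_tuple /= !size_behead size_tuple.
move=> i; rewrite size_tuple => lt_i.
by rewrite -(tnth_nth 0 _ (Ordinal lt_i)) tnth_mktuple.
Qed.

Lemma RE_sum F b :
  RE b -> RE (fun v => F (nth 0 v 0) (behead v)) ->
  RE (fun v => \sum_(0 <= i < b v) F i v).
Proof.
move=> Hb HF.
apply: (RE_ext (f := fun v => prec 0 (fun i y => y + F i v) (b v))).
  by move=> v; elim: (b v) => [|i /= ->]; [rewrite big_geq | rewrite big_nat_recr].
apply: (RE_prec (a := fun=> 0) (G := fun i y v => y + F i v)) => //.
  exact: RE_const.
apply: RE_add; first by re_nth.
exact: (RE_skip HF).
Qed.

Lemma RE_neg P : RE (fun v => P v : bool) -> RE (fun v => ~~ P v).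
Proof.
move=> HP; apply: (RE_ext (f := fun v => 1 - P v)) => [v|]; first by case: (P v).
by apply: RE_sub => //; exact: RE_const.
Qed.

Lemma RE_and P Q : RE (fun v => P v : bool) -> RE (fun v => Q v : bool) ->
  RE (fun v => P v && Q v).
Proof.
move=> HP HQ; apply: (RE_ext (f := fun v => P v * Q v)) => [v|].
  by case: (P v); case: (Q v).
exact: RE_mul.
Qed.

Lemma RE_eq0 f : RE f -> RE (fun v => f v == 0).
Proof.
move=> Hf; apply: (RE_ext (f := fun v => 1 - f v)) => [v|].
  by case: (f v) => // n; rewrite subSS sub0n.
by apply: RE_sub => //; exact: RE_const.
Qed.

Lemma RE_leq f g : RE f -> RE g -> RE (fun v => f v <= g v).
Proof. by move=> Hf Hg; apply: RE_eq0; apply: RE_sub. Qed.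

Lemma RE_eq f g : RE f -> RE g -> RE (fun v => f v == g v).
Proof.
move=> Hf Hg; apply: (RE_ext (f := fun v => (f v <= g v) && (g v <= f v))).
  by move=> v; rewrite eqn_leq.
by apply: RE_and; apply: RE_leq.
Qed.

Lemma RE_if P f g : RE (fun v => P v : bool) -> RE f -> RE g ->
  RE (fun v => if P v then f v else g v).
Proof.
move=> HP Hf Hg.
apply: (RE_ext (f := fun v => P v * f v + ~~ P v * g v)) => [v|].
  by case: (P v); rewrite !(mul1n, mul0n, addn0).
by apply: RE_add; apply: RE_mul => //; apply: RE_neg.
Qed.

Lemma RE_all P b :
  RE b -> RE (fun v => P (nth 0 v 0) (behead v) : bool) ->
  RE (fun v => all (fun i => P i v) (iota 0 (b v))).
Proof.
move=> Hb HP.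
apply: (RE_ext (f := fun v => \sum_(0 <= i < b v) ~~ P i v == 0)) => [v|].
  rewrite sum_nat_seq_eq0 /index_iota subn0; congr nat_of_bool.
  by apply: eq_all => i /=; rewrite eqb0 negbK.
by apply/RE_eq0/(RE_sum (F := fun i v => ~~ P i v)) => //; exact: RE_neg.
Qed.

(** The quotient of m by d > 0 is the number of i < m with (i + 1) d <= m. The conjunct [0 < d]
    reproduces the convention that division by 0 yields 0. *)
Lemma RE_div f g : RE f -> RE g -> RE (fun v => f v %/ g v).
Proof.
apply: (RE_comp2 (f := divn)).
pose F i v := (i.+1 * nth 0 v 1 <= nth 0 v 0) && (0 < nth 0 v 1) : nat.
apply: (RE_ext (f := fun v => \sum_(0 <= i < nth 0 v 0) F i v)) => [v|].
  rewrite /F; move: (nth 0 v 0) (nth 0 v 1) => m [|d].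
    by rewrite divn0 big1 // => i _; rewrite andbF.
  rewrite (eq_bigr (fun i => (i < m %/ d.+1) : nat)) => [|i _]; last first.
    by rewrite andbT leq_divRL.
  rewrite -big_mkcond /= sum1_count.
  have le_q : m %/ d.+1 <= m by exact: leq_div.
  rewrite /index_iota subn0 -[X in iota _ X](subnKC le_q) iotaD count_cat.
  rewrite (eq_in_count (a2 := predT)) ?count_predT ?size_iota => [|i]; last first.
    by rewrite mem_iota.
  rewrite (eq_in_count (a2 := pred0)) ?count_pred0 ?addn0 // => i.
  by rewrite mem_iota add0n => /andP[/= le_i _]; rewrite ltnNge le_i.
apply: RE_sum; first exact: RE_nth.
by apply: RE_and; apply: RE_leq; do ?apply: RE_mul; do ?apply: RE_succ;
  do ?[re_nth | exact: RE_const].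
Qed.

Lemma RE_mod f g : RE f -> RE g -> RE (fun v => f v %% g v).
Proof.
move=> Hf Hg; apply: (RE_ext (f := fun v => f v - f v %/ g v * g v)).
  by move=> v; rewrite {1}(divn_eq (f v) (g v)) addKn.
by apply: RE_sub => //; apply: RE_mul => //; apply: RE_div.
Qed.

(** The largest solution below [b], or 0 if there is none. The bound makes the search an instance of
    primitive recursion. *)
Definition search (P : pred nat) (b : nat) : nat :=
  prec 0 (fun i y => if P i then i else y) b.

Lemma RE_search P b :
  RE b -> RE (fun v => P (nth 0 v 0) (behead v) : bool) ->
  RE (fun v => search (fun i => P i v) (b v)).
Proof.
move=> Hb HP; apply: (RE_prec (a := fun=> 0) (G := fun i y v => if P i v then i else y)).
- exact: RE_const.
- exact: Hb.
- by apply: RE_if; [exact: (RE_skip HP) | re_nth | re_nth].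
Qed.

Lemma searchP (P : pred nat) b i : i < b -> P i ->
  search P b < b /\ P (search P b).
Proof.
rewrite /search; elim: b => //= b IHb; rewrite ltnS leq_eqVlt.
case: ifP => [//|nPb]; case: eqP => [-> _|_ /= lt_ib] Pi; first by rewrite Pi in nPb.
by have [lt_z Pz] := IHb lt_ib Pi; split=> //; apply: leqW.
Qed.

Ltac re_step ::=
  match goal with
  | |- RE (fun v => @?f v + @?g v) => refine (@RE_add f g _ _)
  | |- RE (fun v => @?f v * @?g v) => refine (@RE_mul f g _ _)
  | |- RE (fun v => @?f v - @?g v) => refine (@RE_sub f g _ _)
  | |- RE (fun v => @?f v ^ @?g v) => refine (@RE_exp f g _ _)
  | |- RE (fun v => @?f v %/ @?g v) => refine (@RE_div f g _ _)
  | |- RE (fun v => @?f v %% @?g v) => refine (@RE_mod f g _ _)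
  | |- RE (fun v => S (@?f v)) => refine (@RE_succ f _)
  | |- RE (fun v => predn (@?f v)) => refine (@RE_pred f _)
  | |- RE (fun v => nat_of_bool (@?f v && @?g v)) =>
      refine (@RE_and f g _ _)
  | |- RE (fun v => nat_of_bool (~~ @?f v)) => refine (@RE_neg f _)
  | |- RE (fun v => nat_of_bool (@eq_op _ (@?f v) (@?g v))) =>
      refine (@RE_eq f g _ _)
  | |- RE (fun v => nat_of_bool (@?f v <= @?g v)) =>
      refine (@RE_leq f g _ _)
  | |- RE (fun v => \sum_(0 <= i < @?b v) @?f v i) =>
      refine (@RE_sum (fun i v => f v i) b _ _)
  | |- RE (fun v => nat_of_bool (all (@?f v) (iota 0 (@?b v)))) =>
      refine (@RE_all (fun i v => f v i) b _ _)
  | |- RE (fun v => search (@?p v) (@?b v)) =>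
      refine (@RE_search (fun i v => p v i) b _ _)
  | |- RE (fun v => prec (@?a v) (@?g v) (@?b v)) =>
      refine (@RE_prec a (fun i y v => g v i y) b _ _ _)
  | |- _ => re_user
  end.

(* [2 ^ i] is the exact power of 2 that divides the code [c]. *)
Definition code_head (c : nat) : nat :=
  search (fun i => (c %/ 2 ^ i * 2 ^ i == c) && (c %/ 2 ^ i %% 2 == 1)) c.

Definition code_tail (c : nat) : nat := c %/ 2 ^ code_head c %/ 2.

Definition code_drop (i c : nat) : nat := prec c (fun _ y => code_tail y) i.

Definition code_nth (c i : nat) : nat := code_head (code_drop i c).

Lemma RE_code_head f : RE f -> RE (fun v => code_head (f v)).
Proof. by apply: RE_comp1; rewrite /code_head; re. Qed.

Lemma RE_code_nth f g : RE f -> RE g -> RE (fun v => code_nth (f v) (g v)).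
Proof.
move=> Hf Hg; apply: RE_code_head.
have Htail h : RE h -> RE (fun v => code_tail (h v)).
  apply: RE_comp1; rewrite /code_tail.
  by re; do ?[apply: RE_code_head; re].
have Hdrop : RE (fun v => code_drop (nth 0 v 0) (nth 0 v 1)).
  by rewrite /code_drop; re; apply: Htail; re.
exact: RE_comp2 Hdrop Hg Hf.
Qed.

Lemma code_head_cons x s : code_head (CodeSeq.code (x :: s)) = x.
Proof.
rewrite /code_head /=; set m := CodeSeq.code s; set c := 2 ^ x * _.
have c_gt0 : 0 < c by rewrite muln_gt0 expn_gt0.
have Hx : (c %/ 2 ^ x * 2 ^ x == c) && (c %/ 2 ^ x %% 2 == 1).
  by rewrite /c mulKn ?expn_gt0 // mulnC eqxx modn2 /= odd_double.
(* The bound [c] of the search suffices because x < 2 ^ x <= c. *)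
have lt_xc : x < c.
  by apply: leq_trans (ltn_expl x (ltnSn 1)) _; rewrite /c leq_pmulr.
set P := fun i => _; have [_ /andP[/eqP Dz Oz]] := @searchP P c x lt_xc Hx.
move: (search P c) Dz Oz => z Dz Oz.
(* The search predicate has a single solution, the 2-adic valuation of [c]. *)
have logz y : c %/ 2 ^ y * 2 ^ y = c -> c %/ 2 ^ y %% 2 == 1 -> logn 2 c = y.
  move=> {2}<-; rewrite modn2 eqb1 => Oy.
  rewrite lognM ?expn_gt0 //; last by case: (_ %/ _) Oy.
  by rewrite pfactorK // lognE /= dvdn2 Oy andbF.
by case/andP: Hx => /eqP Dx Ox; rewrite -(logz _ Dz Oz) (logz _ Dx Ox).
Qed.

Lemma code_tail_cons x s :
  code_tail (CodeSeq.code (x :: s)) = CodeSeq.code s.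
Proof.
rewrite /code_tail code_head_cons /= mulKn ?expn_gt0 //.
by rewrite divn2 -addn1 halfD /= odd_double doubleK addn0.
Qed.

Lemma code_nthE s i : i < size s -> code_nth (CodeSeq.code s) i = nth 0 s i.
Proof.
rewrite /code_nth => lt_i.
have -> : code_drop i (CodeSeq.code s) = CodeSeq.code (drop i s).
  elim: i lt_i => [_|i IHi lt_i]; first by rewrite drop0.
  rewrite -[LHS]/(code_tail (code_drop i _)).
  by rewrite IHi ?(ltnW lt_i) // (drop_nth 0) ?(ltnW lt_i) // code_tail_cons.
by rewrite (drop_nth 0) // code_head_cons.
Qed.

(** Prepends f 0, ..., f (n - 1) to the list coded by [c]. As each step adds a head, the values are
    pushed from the last to the first. *)
Definition code_cat (f : nat -> nat) (n c : nat) : nat :=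
  prec c (fun i y => 2 ^ f (n - i.+1) * (2 * y).+1) n.

Lemma code_catE f n s :
  code_cat f n (CodeSeq.code s) = CodeSeq.code (mkseq f n ++ s).
Proof.
rewrite /code_cat; set G := fun i y => _.
suff H i : i <= n -> prec (CodeSeq.code s) G i
    = CodeSeq.code (drop (n - i) (mkseq f n) ++ s).
  by rewrite H // subnn drop0.
elim: i => [|i IHi] lt_in; first by rewrite subn0 drop_oversize ?size_mkseq.
have lt_n : n - i.+1 < n by rewrite ltn_subrL (leq_ltn_trans _ lt_in).
rewrite (drop_nth 0 (n := n - i.+1)) ?size_mkseq // nth_mkseq // subnSK //.
by rewrite /= (IHi (ltnW lt_in)) /G mul2n.
Qed.

Lemma RE_code_cat F n c :
  RE (fun v => F (nth 0 v 0) (behead v)) -> RE n -> RE c ->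
  RE (fun v => code_cat (fun i => F i v) (n v) (c v)).
Proof.
move=> HF Hn Hc.
have HF2 : RE (fun v => F (nth 0 v 0) (behead (behead (behead v)))).
  exact: (RE_skip (RE_skip HF)).
have Hi : RE (fun v => n (behead (behead v)) - (nth 0 v 0).+1).
  re; exact: RE_behead (RE_behead Hn).
have HFi := RE_let (F := fun x v => F x (behead (behead v))) HF2 Hi.
apply: (RE_prec (G := fun i y v => 2 ^ F (n v - i.+1) v * (2 * y).+1)) => //.
by re.
Qed.

(** * Finite automata *)

(** The exact number of states is recorded because the program has to compute it before it searches
    for a table. *)
Definition recog (S : finType) (d : nat) (L : seq S -> bool) : Prop :=
  exists (Q : finType) (q0 : Q) (delta : Q -> S -> Q) (F : pred Q),
    #|Q| = d /\ forall w, F (foldl delta q0 w) = L w.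

Lemma recog_ext (S : finType) d (L L' : seq S -> bool) :
  L =1 L' -> recog d L -> recog d L'.
Proof. by move=> /funext ->. Qed.

Lemma recog_comb (S : finType) d1 d2 (L1 L2 : seq S -> bool)
    (op : bool -> bool -> bool) :
  recog d1 L1 -> recog d2 L2 -> recog (d1 * d2) (fun w => op (L1 w) (L2 w)).
Proof.
move=> [Q1 [q1 [e1 [F1 [<- H1]]]]] [Q2 [q2 [e2 [F2 [<- H2]]]]].
exists (Q1 * Q2)%type, (q1, q2), (fun q s => (e1 q.1 s, e2 q.2 s)).
exists (fun q => op (F1 q.1) (F2 q.2)); rewrite card_prod; split=> // w.
rewrite -H1 -H2.
by elim: w q1 q2 {H1 H2} => //= s w IHw q1 q2; rewrite IHw.
Qed.

Lemma recog_and (S : finType) d1 d2 (L1 L2 : seq S -> bool) :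
  recog d1 L1 -> recog d2 L2 -> recog (d1 * d2) (fun w => L1 w && L2 w).
Proof. exact: recog_comb. Qed.

Lemma recog_neg (S : finType) d (L : seq S -> bool) :
  recog d L -> recog d (fun w => ~~ L w).
Proof.
move=> [Q [q0 [e [F [<- H]]]]]; exists Q, q0, e, (fun q => ~~ F q).
by split=> // w; rewrite H.
Qed.

Lemma recog_map (S S' : finType) (f : S' -> S) d (L : seq S -> bool) :
  recog d L -> recog d (fun w => L (map f w)).
Proof.
move=> [Q [q0 [e [F [<- H]]]]]; exists Q, q0, (fun q s => e q (f s)), F.
by split=> // w; rewrite -H; elim: w q0 {H} => //= s w IHw q0.
Qed.

Lemma recog_ord (S : finType) d (L : seq S -> bool) : recog d L ->
  exists (q0 : 'I_d) (delta : 'I_d -> S -> 'I_d) (F : pred 'I_d),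
    forall w, F (foldl delta q0 w) = L w.
Proof.
move=> [Q [q0 [e [F [<- H]]]]].
exists (enum_rank q0), (fun q s => enum_rank (e (enum_val q) s)).
exists (fun q => F (enum_val q)) => w; rewrite -H; congr F.
rewrite -[q0 in RHS]enum_rankK; elim: w (enum_rank q0) {H} => //= s w IHw q.
by rewrite IHw enum_rankK.
Qed.

(* Subset construction; the initial set contains the states reached by the words
   that project to zeros only, so that a witness may be longer than the word. *)
Lemma recog_proj (S G : finType) (f : S -> G) (z : G) d (L : seq S -> bool) :
  recog d L ->
  recog (2 ^ d)
    (fun u => `[< exists j w, map f w = nseq j z ++ u /\ L w >]).
Proof.
move=> [Q [q0 [e [F [<- H]]]]].
pose X0 := [set q | `[< exists w, map f w = nseq (size w) z /\ foldl e q0 w = q >]].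
pose D (X : {set Q}) g := [set e q s | q in X, s in [set s | f s == g]].
pose A (X : {set Q}) := [exists q in X, F q].
exists {set Q}, X0, D, A; split.
  by rewrite -cardsT -powersetT card_powerset cardsT.
(* After reading [u], the subset consists of the states reachable from [X] by the words that project
   to [u]. *)
have inD X u q : q \in foldl D X u <->
    exists2 p, p \in X & exists2 w, map f w = u & foldl e p w = q.
  elim: u X => [|g u IHu] X /=; split.
  - by move=> Xq; exists q => //; exists [::].
  - by move=> [p Xp [w]]; case: w => [|g u] H1 //= H2; rewrite -H2.
  - move=> /IHu[p1 /imset2P[p s Xp]]; rewrite inE => /eqP fs -> [w fw Dq].
    by exists p => //; exists (s :: w); rewrite //= fs fw.
  - move=> [p Xp [w]]; case: w => [|s w] //= [fs fw] Dq; apply/IHu; exists (e p s).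
      by apply/imset2P; exists p s => //; rewrite inE fs.
    by exists w.
move=> u; apply/idP/asboolP.
  case/exists_inP=> q /inD[p]; rewrite inE => /asboolP[v [fv Dp]] [w fw Dq] Fq.
  exists (size v), (v ++ w); rewrite map_cat fv fw; split=> //.
  by rewrite -H foldl_cat Dp Dq.
move=> [j [w [fw]]]; rewrite -H => Fw.
have Dj : map f (take j w) = nseq j z by rewrite map_take fw take_size_cat ?size_nseq.
have Du : map f (drop j w) = u by rewrite map_drop fw drop_size_cat ?size_nseq.
apply/exists_inP; exists (foldl e q0 w) => //; apply/inD.
exists (foldl e q0 (take j w)).
  by rewrite inE; apply/asboolP; exists (take j w); rewrite -[size _](size_map f) Dj size_nseq.
by exists (drop j w); rewrite // -foldl_cat cat_take_drop.
Qed.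

Definition dropz (S : eqType) (z : S) (w : seq S) : seq S :=
  drop (find (fun s => s != z) w) w.

Lemma dropz_cat (S : eqType) (z : S) j w :
  head z w != z \/ w = [::] -> dropz z (nseq j z ++ w) = w.
Proof.
move=> Hw; elim: j => [|j IHj]; last by rewrite /dropz /= eqxx.
by rewrite /dropz; case: Hw => [|-> //]; case: w => [|s w] //= ->; rewrite ?drop0.
Qed.

Lemma dropzP (S : eqType) (z : S) w :
  w = nseq (find (fun s => s != z) w) z ++ dropz z w.
Proof.
rewrite /dropz; elim: w => //= s w IHw.
by case: eqP => [->|_] //=; rewrite -IHw.
Qed.

(** The added state [None] means that only leading zeros have been read so far. *)
Definition zstep (S : eqType) (z : S) (Q : Type) (q0 : Q) (delta : Q -> S -> Q)
    (o : option Q) (s : S) : option Q :=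
  if o is Some q then Some (delta q s)
  else if s == z then None else Some (delta q0 s).

Lemma zstepE (S : eqType) (z : S) Q (q0 : Q) (delta : Q -> S -> Q) w :
  odflt q0 (foldl (zstep z q0 delta) None w) = foldl delta q0 (dropz z w).
Proof.
have HS q u : foldl (zstep z q0 delta) (Some q) u = Some (foldl delta q u).
  by elim: u q => //= s u IHu q; rewrite IHu.
rewrite /dropz; elim: w => //= s w IHw.
by case: eqP => [_|_] /=; rewrite ?HS.
Qed.

Lemma recog_strip (S : finType) (z : S) d (L : seq S -> bool) :
  recog d L -> recog d.+1 (fun w => L (dropz z w)).
Proof.
move=> [Q [q0 [e [F [<- H]]]]].
exists (option Q), None, (zstep z q0 e), (fun o => F (odflt q0 o)).
by rewrite card_option; split=> // w; rewrite zstepE H.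
Qed.

Section Pumping.
Variables (Q : finType) (S : Type) (delta : Q -> S -> Q).

(** Pigeonhole on the states reached after the prefixes of lengths 0, ..., [#|Q|]. *)
Lemma foldl_pump q w : #|Q| <= size w ->
  exists w1 w2 w3, [/\ w = w1 ++ w2 ++ w3, 0 < size w2
    & foldl delta q (w1 ++ w2) = foldl delta q w1].
Proof.
move=> le_w; pose f (i : 'I_#|Q|.+1) := foldl delta q (take i w).
have /injectivePn[i [j ne_ij Dij]] : ~~ injectiveb f.
  apply/injectiveP => /leq_card; rewrite card_ord.
  by rewrite ltnn.
wlog lt_ij : i j ne_ij Dij / i < j.
  move=> W; case: (ltngtP i j) => [||/val_inj eq_ij]; first exact: (W i j).
    by apply: (W j i); rewrite // eq_sym.
  by rewrite eq_ij eqxx in ne_ij.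
have le_j : j <= size w by apply: leq_trans le_w; rewrite -ltnS.
exists (take i w), (drop i (take j w)), (drop j w).
have Dj : take i w ++ drop i (take j w) = take j w.
  by rewrite -[in RHS](cat_take_drop i (take j w)) take_takel // ltnW.
rewrite catA Dj cat_take_drop; split=> //.
by rewrite size_drop size_takel // subn_gt0.
Qed.

Lemma foldl_short q w :
  exists2 w', size w' < #|Q| & foldl delta q w' = foldl delta q w.
Proof.
have [n] := ubnP (size w); elim: n w => // n IHn w; rewrite ltnS => le_wn.
have [lt_w|le_w] := ltnP (size w) #|Q|; first by exists w.
have [w1 [w2 [w3 [Dw w2_gt0 Dq]]]] := foldl_pump q le_w.
have [|w' lt_w' Dw'] := IHn (w1 ++ w3).
  apply: leq_trans le_wn; rewrite Dw !size_cat ltn_add2l.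
  by rewrite -[ltnLHS]add0n ltn_add2r.
exists w' => //; rewrite Dw' Dw catA foldl_cat -Dq -foldl_cat //.
Qed.

End Pumping.

(** In the product automaton, every reachable pair of states is reached by a word shorter than the
    number of pairs. *)
Lemma dfa_eq (S : Type) (Q1 Q2 : finType) (e1 : Q1 -> S -> Q1) (e2 : Q2 -> S -> Q2)
    (F1 : pred Q1) (F2 : pred Q2) q1 q2 :
  (forall w, size w < #|Q1| * #|Q2| ->
     F1 (foldl e1 q1 w) = F2 (foldl e2 q2 w)) ->
  forall w, F1 (foldl e1 q1 w) = F2 (foldl e2 q2 w).
Proof.
move=> H w; pose e (q : Q1 * Q2) s := (e1 q.1 s, e2 q.2 s).
have He u : foldl e (q1, q2) u = (foldl e1 q1 u, foldl e2 q2 u).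
  by elim: u q1 q2 {H} => //= s u IHu p1 p2; rewrite IHu.
have [w'] := foldl_short e (q1, q2) w.
by rewrite card_prod !He => /H Hw [<- <-].
Qed.

(** * Numeration systems with an adder *)

Section Numeration.
Variables (U : nat -> nat) (hU : numeration_system U).

Lemma U0 : U 0 = 1. Proof. by case: hU. Qed.

Lemma ltn_U : {mono U : m n / m < n}.
Proof. by case: hU => _ /leq_mono/leqW_mono. Qed.

Lemma leq_U : {mono U : m n / m <= n}.
Proof. by move=> m n; rewrite leqNgt ltn_U -leqNgt. Qed.

Lemma ltn_id_U n : n < U n.
Proof. by elim: n => [|n IHn]; rewrite ?U0 // (leq_ltn_trans IHn) // ltn_U. Qed.

Lemma U_gt0 n : 0 < U n.
Proof. exact: leq_ltn_trans (ltn_id_U n). Qed.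

Fixpoint wval (w : seq nat) : nat :=
  if w is d :: v then d * U (size v) + wval v else 0.

(** These are the greedy representations with any number of leading zeros, as needed to read several
    numbers in parallel. The first conjunct excludes an oversized leading digit, since [greedy] does
    not bound its first quotient. *)
Definition valid (w : seq nat) : bool :=
  (wval w < U (size w)) && (greedy U (size w) (wval w) == w).

Lemma size_greedy t n : size (greedy U t n) = t.
Proof. by elim: t n => //= t IHt n; rewrite IHt. Qed.

Lemma wval_greedy t n : n < U t -> wval (greedy U t n) = n.
Proof.
elim: t n => [|t IHt] n lt_n; first by move: lt_n; rewrite U0 ltnS leqn0 => /eqP.
by rewrite /= size_greedy IHt ?ltn_mod ?U_gt0 // -divn_eq.
Qed.

Lemma valid_greedy t n : n < U t -> valid (greedy U t n).
Proof. by move=> lt_n; rewrite /valid size_greedy wval_greedy // lt_n eqxx. Qed.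

Lemma valid_greedyE w : valid w -> greedy U (size w) (wval w) = w.
Proof. by case/andP=> _ /eqP. Qed.

Lemma wval_nseq0 j w : wval (nseq j 0 ++ w) = wval w.
Proof. by elim: j. Qed.

Lemma wval_eq0 w : (wval w == 0) = all (pred1 0) w.
Proof. by elim: w => //= d w <-; rewrite addn_eq0 muln_eq0 -[U _ == 0]negbK -lt0n U_gt0 orbF. Qed.

Definition len n := find (fun t => n < U t) (iota 0 n.+1).

(** This equivalence replaces the definition of [len] by [find] from here on. *)
Lemma len_leq n t : (len n <= t) = (n < U t).
Proof.
have has_n : has (fun t => n < U t) (iota 0 n.+1).
  by apply/hasP; exists n; rewrite ?mem_iota ?ltn_id_U //=.
have lt_len : len n < n.+1 by rewrite -[n.+1](size_iota 0) -has_find.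
have len_n : n < U (len n).
  by have := nth_find 0 has_n; rewrite nth_iota.
apply/idP/idP => [le_len|]; first by apply: leq_trans len_n _; rewrite leq_U.
move=> lt_n; rewrite leqNgt; apply/negP => lt_t.
have := before_find 0 lt_t; rewrite nth_iota ?lt_n //.
exact: ltn_trans lt_len.
Qed.

Lemma ltn_U_len n : n < U (len n). Proof. by rewrite -len_leq. Qed.

Lemma size_rep n : size (rep U n) = len n. Proof. exact: size_greedy. Qed.

Lemma greedyS t n : n < U t -> greedy U t.+1 n = 0 :: greedy U t n.
Proof. by move=> lt_n /=; rewrite divn_small ?modn_small. Qed.

Lemma greedy_nseq t e n : n < U t -> greedy U (e + t) n = nseq e 0 ++ greedy U t n.
Proof.
move=> lt_n; elim: e => // e IHe; rewrite addSn greedyS ?IHe //.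
by apply: leq_trans lt_n _; rewrite leq_U leq_addl.
Qed.

Lemma greedy_pad t n : n < U t -> greedy U t n = pad t (rep U n).
Proof.
move=> lt_n; rewrite /pad size_rep -greedy_nseq ?ltn_U_len //.
by rewrite subnK // len_leq.
Qed.

Lemma rep0 : rep U 0 = [::].
Proof. by rewrite /rep /= U0. Qed.

(** The default value 1 covers the empty representation of 0. *)
Lemma head_rep n : head 1 (rep U n) != 0.
Proof.
rewrite /rep -/(len n); case Dt: (len n) => [|t] //=.
by rewrite -lt0n divn_gt0 ?U_gt0 // leqNgt -len_leq Dt ltnn.
Qed.

Lemma dropz_greedy t n : n < U t -> dropz 0 (greedy U t n) = rep U n.
Proof.
move=> lt_n; rewrite greedy_pad // dropz_cat //.
by have := head_rep n; case: (rep U n) => [|d w]; [right | left].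
Qed.

Lemma valid_nseq0 j w : valid (nseq j 0 ++ w) = valid w.
Proof.
apply/idP/idP; last first.
  case/andP=> lt_w /eqP Dw; rewrite /valid wval_nseq0 size_cat size_nseq.
  rewrite greedy_nseq // Dw eqxx andbT (leq_trans lt_w) // leq_U leq_addl //.
elim: j => //= j IHj vd_w; apply: IHj; move: (nseq j 0 ++ w) vd_w => v.
rewrite /valid /= add0n; case/andP=> _ /eqP[/eqP].
by rewrite -leqn0 -ltnS ltn_divLR ?U_gt0 // mul1n => lt_v;
  rewrite modn_small // => ->; rewrite lt_v eqxx.
Qed.

Lemma size_pad t w : size w <= t -> size (pad t w) = t.
Proof. by move=> le_w; rewrite size_cat size_nseq subnK. Qed.

Lemma pad_pad t T w : size w <= T <= t -> pad t w = nseq (t - T) 0 ++ pad T w.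
Proof.
by case/andP=> le_w le_T; rewrite /pad catA -nseqD; congr (nseq _ _ ++ _); lia.
Qed.

Lemma valid_pad t n : len n <= t -> valid (pad t (rep U n)).
Proof. by rewrite len_leq => lt_n; rewrite -greedy_pad ?valid_greedy. Qed.

Lemma wval_pad t n : wval (pad t (rep U n)) = n.
Proof. by rewrite wval_nseq0 wval_greedy ?ltn_U_len. Qed.

Lemma zip_nseq (S T : Type) j (x : S) (y : T) s t :
  zip (nseq j x ++ s) (nseq j y ++ t) = nseq j (x, y) ++ zip s t.
Proof. by elim: j => //= j ->. Qed.

(** * Automata obtained from the adder *)

Section Adder.
Variables (k' : nat).
Local Notation k := k'.+1.
Variable M : dfao ('I_k * 'I_k * 'I_k)%type bool.
Hypothesis adderP : forall w : seq (nat * nat * nat),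
    (exists2 w', digits3 w' = w & run M w') <->
    (exists a b c : nat, a + b = c /\ w = pad3 (rep U a) (rep U b) (rep U c)).

Definition add_lang (w : seq (nat * nat * nat)) : bool :=
  let a := map (fun c => c.1.1) w in let b := map (fun c => c.1.2) w in
  let c := map snd w in
  [&& valid a, valid b, valid c & wval a + wval b == wval c].

Lemma add_langP w : add_lang w <-> exists t a b c, [/\ a + b = c, c < U t
  & w = zip (zip (pad t (rep U a)) (pad t (rep U b))) (pad t (rep U c))].
Proof.
split=> [/and4P[va vb vc /eqP Dc] | [t [a [b [c [Dc lt_c ->]]]]]].
  exists (size w), (wval (map (fun c => c.1.1) w)).
  exists (wval (map (fun c => c.1.2) w)), (wval (map snd w)).
  have lt_w f : valid (map f w) -> wval (map f w) < U (size w).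
    by case/andP; rewrite size_map.
  split; rewrite ?lt_w // -!greedy_pad ?lt_w //.
  have gE f : valid (map f w) -> greedy U (size w) (wval (map f w)) = map f w.
    by move=> /valid_greedyE; rewrite size_map.
  by rewrite !gE //; elim: (w) => //= [[[? ?] ?] ? <-].
have lt_a : len a <= t by rewrite len_leq; apply: leq_ltn_trans lt_c; lia.
have lt_b : len b <= t by rewrite len_leq; apply: leq_ltn_trans lt_c; lia.
rewrite -len_leq in lt_c.
have Sz n : len n <= t -> size (pad t (rep U n)) = t.
  by move=> le_n; rewrite size_pad ?size_rep.
rewrite /add_lang.
set z := zip _ _; have -> : map (fun c => c.1.1) z = unzip1 (unzip1 z).
  by rewrite /unzip1 /unzip2 -map_comp.
have -> : map (fun c => c.1.2) z = unzip2 (unzip1 z) by rewrite /unzip1 /unzip2 -map_comp.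
have -> : map snd z = unzip2 z by [].
rewrite !(unzip1_zip, unzip2_zip) ?size_zip ?Sz ?minnn //.
by rewrite !valid_pad // !wval_pad Dc eqxx.
Qed.

Definition z3 : ('I_k * 'I_k * 'I_k)%type :=
  ((ord0 : 'I_k, ord0 : 'I_k), ord0 : 'I_k).

(** The adder accepts only triples padded to the longest of the three representations. Stripping the
    leading zero triples extends it to every padding, at the cost of one state. *)
Lemma recog_add : recog (dfao_states M).+1
  (fun w : seq ('I_k * 'I_k * 'I_k) => add_lang (digits3 w)).
Proof.
have : recog (dfao_states M).+1 (fun w => run M (dropz z3 w)).
  apply: (@recog_strip _ z3 _ (run M)).
  exists 'I_(dfao_states M), (dfao_init M), (@dfao_trans _ _ M), (@dfao_out _ _ M).
  by rewrite card_ord.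
apply: recog_ext => w; apply/idP/idP.
  move=> Mw; have [/(_ (ex_intro2 _ _ (dropz z3 w) erefl Mw)) H _] :=
    adderP (digits3 (dropz z3 w)).
  have [a [b [c [Dc Dw]]]] := H; apply/add_langP.
  set T := maxn (maxn (size (rep U a)) (size (rep U b))) (size (rep U c)).
  have := dropzP z3 w; move: (find _ w) => j Dw'.
  exists (j + T), a, b, c; split=> //.
    by rewrite -len_leq -size_rep /T; lia.
  rewrite Dw' /digits3 map_cat map_nseq -/(digits3 _) Dw.
  have padE r : size r <= T -> pad (j + T) r = nseq j 0 ++ pad T r.
    by move=> le_r; rewrite (pad_pad (T := T)) ?addnK // le_r leq_addl.
  by rewrite /pad3 -/T !padE ?zip_nseq //; rewrite /T; lia.
move=> /add_langP[t [a [b [c [Dc lt_c Dw]]]]].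
have lt_a : len a <= t by rewrite len_leq; apply: leq_ltn_trans lt_c; lia.
have lt_b : len b <= t by rewrite len_leq; apply: leq_ltn_trans lt_c; lia.
rewrite -len_leq in lt_c.
have D3 : digits3 (dropz z3 w) = pad3 (rep U a) (rep U b) (rep U c).
  have -> : digits3 (dropz z3 w) = dropz (0, 0, 0) (digits3 w).
    rewrite /dropz /digits3 find_map map_drop; congr (drop _ _).
  set T := maxn (maxn (size (rep U a)) (size (rep U b))) (size (rep U c)).
  rewrite Dw /pad3 -/T !(@pad_pad t T) ?zip_nseq ?dropz_cat //; last first.
  - by rewrite /T !size_rep; lia.
  - by rewrite /T !size_rep; lia.
  - by rewrite /T !size_rep; lia.
  have := head_rep c; have := head_rep b; have := head_rep a; rewrite /T /pad.
  move: (rep U a) (rep U b) (rep U c) => u v y Hu Hv Hy.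
  clear T; case DT: (maxn _ _) => [|T1].
    right; move/eqP: DT; rewrite -leqn0 !geq_max !leqn0 !size_eq0.
    by case/andP=> /andP[/eqP-> /eqP->] /eqP->.
  have padE r : size r <= T1.+1 ->
      exists d s, nseq (T1.+1 - size r) 0 ++ r = d :: s.
    case: r => [|d r] _; first by exists 0, (nseq T1 0 ++ [::]).
    case: (_ - _) => [|m]; first by exists d, r.
    by exists 0, (nseq m 0 ++ d :: r).
  (* A representation of maximal length receives no padding and starts with a nonzero digit, so the
     first triple is nonzero and nothing more is stripped. *)
  have padN r : head 1 r != 0 -> size r = T1.+1 ->
      exists d s, nseq (T1.+1 - size r) 0 ++ r = d.+1 :: s.
    by case: r => [|[|d] r] // _ Dr; rewrite Dr subnn; exists d, r.
  left; have [Du|Du] := eqVneq (size u) T1.+1.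
    have [d [s ->]] := padN u Hu Du.
    have [|e [s1 ->]] := padE v; first by lia.
    by have [|f [s2 ->]] := padE y; first by lia.
  have [Dv|Dv] := eqVneq (size v) T1.+1.
    have [d [s ->]] := padN _ Hv Dv.
    have [|e [s1 ->]] := padE u; first by lia.
    have [|f [s2 ->]] := padE y; first by lia.
    by rewrite /= !xpair_eqE andbF.
  have [|d [s ->]] := padN y Hy.
    have Nu : size u <> T1.+1 by apply/eqP.
    have Nv : size v <> T1.+1 by apply/eqP.
    by lia.
  have [|e [s1 ->]] := padE u; first by lia.
  have [|f [s2 ->]] := padE v; first by lia.
  by rewrite /= !xpair_eqE andbF.
have [_ /(_ _)[|w' Dw' Mw']] := adderP (digits3 (dropz z3 w)).
  by exists a, b, c.
(* The adder hypothesis yields some word with the same digits; it is the stripped word since [val]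
   is injective on letters. *)
suff -> : dropz z3 w = w' by [].
apply: inj_map (esym Dw') => -[[x y] z] [[x' y'] z'] /= [].
by do 3!move=> /val_inj ->.
Qed.

(** The triple for n + 0 = n is a word over the alphabet of the adder. *)
Lemma rep_lt n : all (fun c => c < k) (rep U n).
Proof.
have [_ [|w]] := adderP (pad3 (rep U n) (rep U 0) (rep U n)).
  by exists n, 0, n; rewrite addn0.
rewrite rep0 /pad3 maxn0 maxnn /pad subnn subn0 cats0 /= => Dw _.
have -> : rep U n = unzip2 (digits3 w) by rewrite Dw unzip2_zip // size_zip size_nseq minnn.
by apply/allP=> c /mapP[_ /mapP[[[x y] z] _ ->] ->] /=.
Qed.

Lemma greedy_lt t n : n < U t -> all (fun c => c < k) (greedy U t n).
Proof. by move=> lt_n; rewrite greedy_pad // /pad all_cat rep_lt andbT all_nseq orbT. Qed.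

Lemma recog_valid :
  recog (dfao_states M).+1 (fun w : seq 'I_k => valid (map val w)).
Proof.
pose f (c : 'I_k) : ('I_k * 'I_k * 'I_k)%type := (c, ord0, c).
apply: recog_ext (recog_map f recog_add) => w.
have Ea : map (fun c => c.1.1) (digits3 (map f w)) = map val w.
  by rewrite /digits3 -!map_comp.
have Eb : map (fun c => c.1.2) (digits3 (map f w)) = nseq (size w) 0 ++ [::].
  by rewrite cats0; elim: (w) => //= ? ? ->.
have Ec : map snd (digits3 (map f w)) = map val w by rewrite /digits3 -!map_comp.
rewrite /add_lang Ea Eb Ec wval_nseq0 valid_nseq0 addn0 eqxx andbT /= andbA andbAC.
by rewrite andbb /valid /= U0 andbT.
Qed.

Lemma recog_nonzero : recog 2 (fun w : seq 'I_k => wval (map val w) != 0).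
Proof.
exists bool, false, (fun b d => b || (val d != 0)), id; rewrite card_bool.
split=> // w; rewrite wval_eq0 all_map; transitivity (has (fun d => val d != 0) w).
  rewrite -[RHS]/(false || _); elim: w false => [|d w IHw] b /=; first by rewrite orbF.
  by rewrite IHw orbA.
by rewrite -has_predC.
Qed.

(** The words of value 1 are those of the form 0...01, as U(t) > 1 for t > 0. [None]: only zeros so
    far; [Some true]: such a word has just been read; [Some false]: failure. *)
Definition one_step (o : option bool) (d : 'I_k) : option bool :=
  if o is Some _ then Some false
  else if val d == 0 then None else Some (val d == 1).

Lemma recog_one : recog 3 (fun w : seq 'I_k => wval (map val w) == 1).
Proof.
exists (option bool), None, one_step, (fun o => o == Some true).
rewrite card_option card_bool; split=> // w.
have dead v : foldl one_step (Some false) v = Some false by elim: v.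
have done b v : (foldl one_step (Some b) v == Some true) = b && nilp v.
  by case: v => [|d v] /=; rewrite ?andbT ?dead ?andbF //; case: b.
elim: w => //= d w IHw; rewrite size_map.
have [->|d_neq0] := eqVneq (val d) 0; first by rewrite IHw.
rewrite done /nilp.
have [->|d_neq1] := eqVneq (val d) 1; rewrite ?mul1n /=.
  case: w {IHw} => [|c w]; first by rewrite /= U0.
  have : 1 < U (size (c :: w)) by exact: leq_ltn_trans (ltn_id_U _).
  by case: (U _) => [|[|u]].
have : 1 < val d by case: (val d) d_neq0 d_neq1 => [|[|]].
move=> d_gt1; apply/esym/gtn_eqF; apply: leq_trans d_gt1 _.
exact: leq_trans (leq_pmulr _ (U_gt0 _)) (leq_addr _ _).
Qed.

(** * Tuples of numbers read on parallel tracks *)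

Section Tracks.
Variable I : finType.
Local Notation letter := {ffun I -> 'I_k}.

Definition track (p : I) (w : seq letter) : seq nat :=
  [seq val (s p) | s : letter <- w].

Lemma size_track p w : size (track p w) = size w. Proof. exact: size_map. Qed.

Definition tracks (t : nat) (e : I -> nat) : seq letter :=
  mkseq (fun j => [ffun p => inord (nth 0 (greedy U t (e p)) j)]) t.

Lemma track_tracks t e p : e p < U t -> track p (tracks t e) = greedy U t (e p).
Proof.
move=> lt_e; apply: (@eq_from_nth _ 0).
  by rewrite size_track size_mkseq size_greedy.
rewrite size_track size_mkseq => j lt_j.
rewrite (nth_map [ffun=> ord0]) ?size_mkseq // nth_mkseq // ffunE /= inordK //.
by apply: (allP (greedy_lt lt_e)); rewrite mem_nth ?size_greedy.
Qed.

Lemma track_inj (w w' : seq letter) : size w = size w' ->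
  (forall p, track p w = track p w') -> w = w'.
Proof.
elim: w w' => [|s w IHw] [|s' w'] //= [eq_sz] Ht; congr (_ :: _).
  by apply/ffunP=> p; apply: val_inj; case: (Ht p).
by apply: IHw => // p; case: (Ht p).
Qed.

Definition vals (w : seq letter) (p : I) : nat := wval (track p w).

Lemma recog_add_tr p q r : recog (dfao_states M).+1
  (fun w : seq letter => [&& valid (track p w), valid (track q w), valid (track r w)
             & vals w p + vals w q == vals w r]).
Proof.
apply: recog_ext (recog_map (fun s : letter => (s p, s q, s r)) recog_add) => w /=.
by rewrite /add_lang /digits3 -!map_comp.
Qed.

Lemma recog_tr (L : seq 'I_k -> bool) d p :
  recog d L -> recog d (fun w : seq letter => L [seq s p | s : letter <- w]).
Proof. exact: recog_map. Qed.

Lemma recog_valid_tr p : recog (dfao_states M).+1 (fun w : seq letter => valid (track p w)).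
Proof.
apply: recog_ext (recog_tr p recog_valid) => w.
by rewrite /track -map_comp.
Qed.

Lemma recog_nonzero_tr p : recog 2 (fun w : seq letter => vals w p != 0).
Proof.
apply: recog_ext (recog_tr p recog_nonzero) => w.
by rewrite /vals /track -map_comp.
Qed.

Lemma recog_one_tr p : recog 3 (fun w : seq letter => vals w p == 1).
Proof.
apply: recog_ext (recog_tr p recog_one) => w.
by rewrite /vals /track -map_comp.
Qed.

End Tracks.

(* Existential quantification over the tracks outside of the image of [i]. *)
Lemma recog_exists (I J : finType) (i : J -> I) d
    (L : seq {ffun I -> 'I_k} -> bool) (P : (I -> nat) -> Prop) :
  recog d L ->
  (forall w, L w -> P (vals w)) ->
  (forall w, (forall p, valid (track p w)) -> P (vals w) -> L w) ->
  (forall e e', e =1 e' -> P e -> P e') ->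
  exists L' : seq {ffun J -> 'I_k} -> bool, recog (2 ^ d) L' /\
    forall u, (forall p, valid (track p u)) ->
      L' u <-> exists2 e, (forall p, e (i p) = vals u p) & P e.
Proof.
move=> HL LP PL extP.
pose f (s : {ffun I -> 'I_k}) := [ffun p => s (i p)] : {ffun J -> 'I_k}.
pose z := [ffun=> ord0] : {ffun J -> 'I_k}.
exists (fun u => `[< exists j w, map f w = nseq j z ++ u /\ L w >]).
split=> [|u vd_u]; first exact: recog_proj.
have tr_f p w : track p (map f w) = track (i p) w.
  by rewrite /track -map_comp; apply: eq_map => s /=; rewrite ffunE.
have tr_z p j w : track p (nseq j z ++ w) = nseq j 0 ++ track p w.
  by rewrite /track map_cat map_nseq ffunE.
split=> [/asboolP[j [w [fw Lw]]]|[e De Pe]].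
  exists (vals w); last exact: LP.
  by move=> p; rewrite /vals -tr_f fw tr_z wval_nseq0.
(* Since n < U n, this length accommodates all the values [e p]. The excess over [size u] is the
   number of zeros put in front of [u]. *)
pose t := size u + \sum_p e p.
have lt_e p : e p < U t.
  apply: leq_ltn_trans (ltn_id_U _); rewrite /t (bigD1 p) //=; lia.
apply/asboolP; exists (\sum_p e p), (tracks t e); split; last first.
  have Dtr p : track p (tracks t e) = greedy U t (e p) by exact: track_tracks.
  apply: PL => [p|]; first by rewrite Dtr valid_greedy.
  by apply: extP Pe => p; rewrite /vals Dtr wval_greedy.
apply: track_inj => [|p]; first by rewrite size_map size_mkseq size_cat size_nseq addnC.
rewrite tr_f track_tracks // tr_z /t addnC De greedy_nseq; last first.
  by have /andP[] := vd_u p; rewrite size_track.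
by rewrite -[size u](size_track p) valid_greedyE.
Qed.

End Adder.
End Numeration.

(** * First occurrences are recognizable *)

(* Numbers of states of the automata built below, from the number [a] of states
   for the adder and the number [m] of states of the given automaton. *)
Definition neq_dim (a m : nat) : nat :=
  a * (a * (3 * (a * (a * (m.+1 * m.+1))))).

Definition occ_dim (a m : nat) : nat :=
  2 ^ (a * (2 * (a * (2 ^ neq_dim a m * 2 ^ neq_dim a m)))) * (a * a).

Section Formula.
Variables (U : nat -> nat) (hU : numeration_system U) (k' : nat).
Local Notation k := k'.+1.
Variable M : dfao ('I_k * 'I_k * 'I_k)%type bool.
Hypothesis adderP : forall w : seq (nat * nat * nat),
    (exists2 w', digits3 w' = w & run M w') <->
    (exists a b c : nat, a + b = c /\ w = pad3 (rep U a) (rep U b) (rep U c)).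
Variables (T : finType) (x : nat -> T) (K : nat) (A : dfao 'I_K T).
Hypothesis Ax : generates U A x.
Local Notation m := (dfao_states A).
Local Notation a := (dfao_states M).+1.

(** The alphabet of the DFAO may differ from that of the adder. A digit outside of the former occurs
    in no representation, so its transition is arbitrary. *)
Definition trans_k (q : 'I_m) (c : 'I_k) : 'I_m :=
  if insub (val c) is Some c' then dfao_trans q c' else q.

Definition state_k (w : seq 'I_k) : option 'I_m :=
  foldl (zstep ord0 (dfao_init A) trans_k) None w.

Definition out_k (o : option 'I_m) : T := dfao_out (odflt (dfao_init A) o).

Lemma out_kE w : valid U (map val w) -> out_k (state_k w) = x (wval U (map val w)).
Proof.
move=> /andP[lt_n /eqP Dw]; set n := wval _ _ in lt_n Dw *.
have [w0 Dw0 ->] := Ax n; rewrite /out_k zstepE /run; congr dfao_out.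
have : map val (dropz ord0 w) = digits w0.
  rewrite Dw0 -(dropz_greedy hU lt_n) Dw /dropz find_map -map_drop.
  by congr (map _ (drop _ _)); apply: eq_find.
elim: (dropz _ w) w0 {Dw0} (dfao_init A) => [|c v IHv] [|c0 w0] q //= [Dc Dv].
rewrite (IHv w0) // /trans_k.
have -> : insub (val c) = Some c0 :> option 'I_K by rewrite [val c]Dc; exact: valK.
by [].
Qed.

Lemma recog_neq_tr (I : finType) (p q : I) : recog (m.+1 * m.+1)
  (fun w : seq {ffun I -> 'I_k} =>
     out_k (state_k [seq s p | s : {ffun I -> 'I_k} <- w]) !=
     out_k (state_k [seq s q | s : {ffun I -> 'I_k} <- w])).
Proof.
pose st := zstep ord0 (dfao_init A) trans_k.
exists (option 'I_m * option 'I_m)%type, (None, None).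
exists (fun o (s : {ffun I -> 'I_k}) => (st o.1 (s p), st o.2 (s q))).
exists (fun o => out_k o.1 != out_k o.2).
rewrite card_prod !card_option card_ord; split=> // w; rewrite /state_k -/st.
set F := fun o s => _; have FE o1 o2 : foldl F (o1, o2) w =
    (foldl st o1 [seq s p | s : {ffun I -> 'I_k} <- w],
     foldl st o2 [seq s q | s : {ffun I -> 'I_k} <- w]).
  by elim: w o1 o2 => //= s w IHw o1 o2; rewrite IHw.
by rewrite FE.
Qed.

Local Notation "''t_' i" := (Ordinal (isT : (i < 9)%N)) (at level 8, i at level 2).

(** Two factors differ directly ([b] true) or up to reversal ([b] false) exactly when some offset l
    < n witnesses it. Inequality is used rather than equality because it is existential and costs a
    single projection. *)
Lemma recog_neq (b : bool) :
  exists L : seq {ffun 'I_3 -> 'I_k} -> bool, recog (2 ^ neq_dim a m) L /\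
    forall u, (forall p, valid U (track p u)) ->
      L u <-> exists2 l, l < vals U u (Ordinal (isT : 0 < 3)) &
        x (vals U u (Ordinal (isT : 1 < 3)) + l) <>
        x (vals U u (Ordinal (isT : 2 < 3)) +
           if b then l else vals U u (Ordinal (isT : 0 < 3)) - l.+1).
Proof.
(* tracks: n, i, j, l, l', h, o, c, d with l + l' = h, h + o = n, o = 1,
   i + l = c, j + (l or l') = d *)
pose s4 : 'I_9 := if b then 't_3 else 't_4.
pose P (e : 'I_9 -> nat) :=
  [/\ e 't_3 + e 't_4 = e 't_5, e 't_5 + e 't_6 = e 't_0 & e 't_6 = 1] /\
  [/\ e 't_1 + e 't_3 = e 't_7, e 't_2 + e s4 = e 't_8 & x (e 't_7) <> x (e 't_8)].
have R := recog_and (recog_add_tr hU adderP 't_3 't_4 't_5)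
  (recog_and (recog_add_tr hU adderP 't_5 't_6 't_0)
  (recog_and (recog_one_tr hU k' 't_6)
  (recog_and (recog_add_tr hU adderP 't_1 't_3 't_7)
  (recog_and (recog_add_tr hU adderP 't_2 s4 't_8) (recog_neq_tr 't_7 't_8))))).
have outE (w : seq {ffun 'I_9 -> 'I_k}) p : valid U (track p w) ->
    out_k (state_k [seq s p | s : {ffun 'I_9 -> 'I_k} <- w]) = x (vals U w p).
  have Dtr : track p w = map val [seq s p | s : {ffun 'I_9 -> 'I_k} <- w].
    by rewrite /track -map_comp.
  by move=> vp; rewrite out_kE ?/vals -?Dtr.
have [|||L' [HL' HP]] :=
  @recog_exists U hU k' M adderP _ _ (widen_ord (isT : 3 <= 9)) _ _ P R.
- move=> w /and5P[/and4P[_ _ _ /eqP H1] /and4P[_ _ _ /eqP H2] /eqP H3].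
  move=> /and4P[_ _ v7 /eqP H4] /andP[/and4P[_ _ v8 /eqP H5]].
  by rewrite !outE // => /eqP H6.
- move=> w vw [[H1 H2 H3] [H4 H5 /eqP H6]].
  by rewrite !outE // !vw H1 H2 H3 H4 H5 !eqxx H6.
- by move=> e e' /funext ->.
exists L'; split=> // u vu; rewrite HP //; split.
  move=> [e De [[H1 H2 H3] [H4 H5 H6]]].
  have D p : vals U u p = e (widen_ord (isT : 3 <= 9) p) by [].
  have [E0 E1 E2] : [/\ vals U u (Ordinal (isT : 0 < 3)) = e 't_0,
    vals U u (Ordinal (isT : 1 < 3)) = e 't_1
    & vals U u (Ordinal (isT : 2 < 3)) = e 't_2].
    by split; rewrite D; congr e; apply: val_inj.
  rewrite E0 E1 E2; exists (e 't_3); first by lia.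
  rewrite H4; suff -> : (if b then e 't_3 else e 't_0 - (e 't_3).+1) = e s4 by rewrite H5.
  by rewrite /s4; case: (b); lia.
set n := vals U u _; set i := vals U u _; set j := vals U u _ => -[l lt_ln Hx].
pose l' := n - l.+1; pose s := if b then l else l'.
exists (fun p : 'I_9 => nth 0 [:: n; i; j; l; l'; l + l'; 1; i + l; j + s] p).
  by case=> [[|[|[|//]]] lt_p] /=; congr vals; apply: val_inj.
rewrite /P /s4 /s /=; split; split=> //; first by rewrite /l'; lia.
by case: (b).
Qed.

Definition first_occ (n i : nat) : bool :=
  [forall j : 'I_i, ~~ refl_eqv (factor x n j) (factor x n i)].

Lemma factor_eqP n i j :
  reflect (forall l, l < n -> x (i + l) = x (j + l))
          (factor x n i == factor x n j).
Proof.
apply: (iffP eqP) => [E l lt_l | E].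
  by have := congr1 (fun t => tnth t (Ordinal lt_l)) E; rewrite !tnth_mktuple.
by apply: eq_from_tnth => l; rewrite !tnth_mktuple /= E.
Qed.

Lemma factor_revP n i j :
  reflect (forall l, l < n -> x (i + l) = x (j + (n - l.+1)))
          (factor x n i == [tuple of rev (factor x n j)]).
Proof.
have Drev l : l < n ->
    nth (x 0) (rev (factor x n j)) l = x (j + (n - l.+1)).
  move=> lt_l; rewrite nth_rev ?size_tuple //.
  have lt_r : n - l.+1 < n by lia.
  by rewrite -[n - l.+1]/(val (Ordinal lt_r)) -tnth_nth tnth_mktuple.
have Dfac l : l < n -> nth (x 0) (factor x n i) l = x (i + l).
  by move=> lt_l; rewrite -[l]/(val (Ordinal lt_l)) -tnth_nth tnth_mktuple.
apply: (iffP eqP) => [E l lt_l | E].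
  by rewrite -Dfac // -Drev // E.
apply: val_inj; apply: (@eq_from_nth _ (x 0)); first by rewrite /= size_rev !size_tuple.
move=> l lt_l; have {}lt_l : l < n by move: lt_l; rewrite size_tuple.
by rewrite Dfac // [RHS]Drev // E.
Qed.

Local Notation fst_tr w := (map (fun c : 'I_k * 'I_k => val c.1) w).
Local Notation snd_tr w := (map (fun c : 'I_k * 'I_k => val c.2) w).

(** The complement is existential: some j < i carries the same factor or its reversal. Each of these
    two alternatives is in turn the negation of a language from [recog_neq]. *)
Lemma recog_first_occ : recog (occ_dim a m)
  (fun w : seq ('I_k * 'I_k) => [&& valid U (fst_tr w), valid U (snd_tr w) &
     first_occ (wval U (fst_tr w)) (wval U (snd_tr w))]).
Proof.
have [L1 [R1 H1]] := recog_neq true; have [L2 [R2 H2]] := recog_neq false.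
pose u4 i lt_i : 'I_4 := @Ordinal 4 i lt_i.
pose g (s : {ffun 'I_4 -> 'I_k}) : {ffun 'I_3 -> 'I_k} :=
  [ffun p => s (widen_ord (isT : 3 <= 4) p)].
(* The tracks are n, i, j and i - j; the condition j < i is expressed by j + (i - j) = i with i - j
   nonzero. *)
pose f0 := u4 0 isT; pose f1 := u4 1 isT; pose f2 := u4 2 isT; pose f3 := u4 3 isT.
have R := recog_and (recog_add_tr hU adderP f2 f3 f1)
  (recog_and (recog_nonzero_tr hU k' f3)
  (recog_and (recog_valid_tr hU adderP f0)
  (recog_neg (recog_and (recog_map g R1) (recog_map g R2))))).
pose P (e : 'I_4 -> nat) := [/\ e f2 + e f3 = e f1, e f3 <> 0 &
  (forall l, l < e f0 -> x (e f1 + l) = x (e f2 + l)) \/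
  (forall l, l < e f0 -> x (e f1 + l) = x (e f2 + (e f0 - l.+1)))].
have gE p w : vals U (map g w) p = vals U w (widen_ord (isT : 3 <= 4) p).
  by rewrite /vals /track -map_comp; congr wval; apply: eq_map => s /=; rewrite ffunE.
have vg w : valid U (track f0 w) -> valid U (track f1 w) -> valid U (track f2 w) ->
    forall p, valid U (track p (map g w)).
  have E p : track p (map g w) = track (widen_ord (isT : 3 <= 4) p) w.
    by rewrite /track -map_comp; apply: eq_map => s /=; rewrite ffunE.
  move=> v0 v1 v2 [[|[|[|//]]] lt_p]; rewrite E.
  - by move: v0; congr (valid _ (track _ _)); apply: val_inj.
  - by move: v1; congr (valid _ (track _ _)); apply: val_inj.
  - by move: v2; congr (valid _ (track _ _)); apply: val_inj.
have F0 : widen_ord (isT : 3 <= 4) (Ordinal (isT : 0 < 3)) = f0 by apply: val_inj.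
have F1 : widen_ord (isT : 3 <= 4) (Ordinal (isT : 1 < 3)) = f1 by apply: val_inj.
have F2 : widen_ord (isT : 3 <= 4) (Ordinal (isT : 2 < 3)) = f2 by apply: val_inj.
have LP w : valid U (track f0 w) -> valid U (track f1 w) -> valid U (track f2 w) ->
    ~~ (L1 (map g w) && L2 (map g w)) <->
    (forall l, l < vals U w f0 -> x (vals U w f1 + l) = x (vals U w f2 + l)) \/
    (forall l, l < vals U w f0 -> x (vals U w f1 + l) =
       x (vals U w f2 + (vals U w f0 - l.+1))).
  move=> v0 v1 v2; have {}vg := vg w v0 v1 v2.
  move: (H1 _ vg) (H2 _ vg); rewrite !gE F0 F1 F2 => {}H1 {}H2.
  rewrite negb_and; split=> [/orP[/negP nL|/negP nL] | [E|E]].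
  - left=> l lt_l; apply/eqP; apply: contra_notT nL => /eqP Nx.
    by apply/H1; exists l.
  - right=> l lt_l; apply/eqP; apply: contra_notT nL => /eqP Nx.
    by apply/H2; exists l.
  - by apply/orP; left; apply/negP=> /H1[l /E].
  - by apply/orP; right; apply/negP=> /H2[l /E].
have [|||L' [R' HP]] :=
  @recog_exists U hU k' M adderP _ _ (widen_ord (isT : 2 <= 4)) _ _ P R.
- move=> w /and4P[/and4P[v2 v3 v1 /eqP E1] /eqP E2 v0 E3].
  by split=> //; apply/LP.
- move=> w vw [E1 E2 E3]; rewrite !vw E1 eqxx /=; apply/andP; split; first exact/eqP.
  by apply/LP.
- by move=> e e' /funext ->.
pose h (c : 'I_k * 'I_k) : {ffun 'I_2 -> 'I_k} :=
  [ffun p => if p == ord0 then c.1 else c.2].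
(* As [L'] is specified on valid words only, its complement is intersected with the validity of both
   tracks. *)
have R2' := recog_map h (recog_and (recog_neg R')
  (recog_and (recog_valid_tr hU adderP ord0) (recog_valid_tr hU adderP ord_max))).
apply: recog_ext R2' => w.
have D0 : track ord0 (map h w) = fst_tr w.
  by rewrite /track -map_comp; apply: eq_map => s /=; rewrite ffunE.
have D1 : track ord_max (map h w) = snd_tr w.
  by rewrite /track -map_comp; apply: eq_map => s /=; rewrite ffunE.
rewrite D0 D1 andbC -andbA.
case v0 : (valid U (fst_tr w)) => //=; case v1 : (valid U (snd_tr w)) => //=.
have vw p : valid U (track p (map h w)).
  case: p => [[|[|//]] lt_p].
    by rewrite (_ : Ordinal _ = ord0) ?D0 //; apply: val_inj.
  by rewrite (_ : Ordinal _ = ord_max) ?D1 //; apply: val_inj.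
apply/negP/forallP => [nL' j | Hj /(HP _ vw)[e De [E1 /eqP E2 E3]]].
  apply/negP => rj; apply: nL'; apply/(HP _ vw).
  pose n := wval U (fst_tr w); pose i := wval U (snd_tr w).
  exists (fun p : 'I_4 => nth 0 [:: n; i; val j; i - j] p).
    by case=> [[|[|//]] lt_p]; rewrite /vals /n /i /= -?D0 -?D1; congr (wval _ (track _ _)); apply: val_inj.
  split=> /=; [by have := ltn_ord j; rewrite -/i; lia.. |].
  by case/orP: rj => [/factor_eqP|/factor_revP]; [left | right].
have e0 : e f0 = wval U (fst_tr w).
  by rewrite -D0 -[wval _ _]/(vals U _ _) -De; congr e; apply: val_inj.
have e1 : e f1 = wval U (snd_tr w).
  by rewrite -D1 -[wval _ _]/(vals U _ _) -De; congr e; apply: val_inj.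
have lt_j : e f2 < wval U (snd_tr w) by rewrite -e1 -E1; lia.
have /negP := Hj (Ordinal lt_j); apply; rewrite -[nat_of_ord _]/(e f2) {lt_j}.
rewrite /refl_eqv -e0 -e1.
by case: E3 => [/factor_eqP|/factor_revP] -> //; rewrite orbT.
Qed.
End Formula.

(** * Counting by a linear representation *)

(** The digit at index j from the left, by iterated remainders: a numerical function, with no list,
    that primitive recursion can compute. *)
Definition greedy_digit (U : nat -> nat) (t n j : nat) : nat :=
  prec n (fun i y => y %% U (t - i.+1)) j %/ U (t - j.+1).

Lemma greedyE U t n : greedy U t n = mkseq (greedy_digit U t n) t.
Proof.
elim: t n => //= t IHt n; rewrite IHt /mkseq /= (iotaDl 1 0) -map_comp.
congr (_ :: _); first by rewrite /greedy_digit /= subn1.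
apply: eq_map => j /=; rewrite /greedy_digit subSS; congr (_ %/ _).
by elim: j => [|j /= ->]; rewrite /= ?subn1 ?subSS.
Qed.

(** * All words over an alphabet of [b] digits, numbered in base [b] *)

Section Base.
Variable b : nat.
Hypothesis b_gt1 : 1 < b.

Lemma expn_numeration : numeration_system (expn b).
Proof. by split=> // m n; rewrite ltn_exp2l. Qed.

Lemma valid_expn w : all (fun d => d < b) w -> valid (expn b) w.
Proof.
elim: w => //= d w IHw /andP[lt_d /IHw /andP[lt_w /eqP Dw]]; rewrite /valid /=.
have b_gt0 : 0 < b ^ size w by rewrite expn_gt0 (ltnW b_gt1).
rewrite divnMDl // divn_small // addn0 modnMDl modn_small // Dw eqxx andbT.
by rewrite expnS; nia.
Qed.

Lemma greedy_expn_lt t z : z < b ^ t -> all (fun d => d < b) (greedy (expn b) t z).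
Proof.
elim: t z => //= t IHt z lt_z; rewrite IHt ?ltn_mod ?expn_gt0 ?(ltnW b_gt1) //.
by rewrite ltn_divLR ?expn_gt0 ?(ltnW b_gt1) // -expnS lt_z.
Qed.

Lemma greedy_expnK w : all (fun d => d < b) w ->
  greedy (expn b) (size w) (wval (expn b) w) = w.
Proof. by move=> /valid_expn /valid_greedyE. Qed.

Lemma wval_expn_lt w : all (fun d => d < b) w -> wval (expn b) w < b ^ size w.
Proof. by move=> /valid_expn /andP[]. Qed.

Lemma sum_greedy_cons t (F : seq nat -> nat) :
  \sum_(0 <= z < b ^ t.+1) F (greedy (expn b) t.+1 z) =
  \sum_(0 <= c < b) \sum_(0 <= z < b ^ t) F (c :: greedy (expn b) t z).
Proof.
have b_gt0 : 0 < b ^ t by rewrite expn_gt0 (ltnW b_gt1).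
rewrite expnS big_nat_mul; apply: eq_bigr => c _.
rewrite mulSn -[X in \sum_(X <= _ < _) _]add0n big_addn addnK.
rewrite !big_nat; apply: eq_bigr => z /= lt_z.
by rewrite addnC divnMDl // divn_small // addn0 modnMDl modn_small.
Qed.

End Base.

(** * Counting the accepted pairs with a given first component *)

Section Count.
Variables (U : nat -> nat) (hU : numeration_system U) (k : nat).
Hypothesis k_gt1 : 1 < k.
Hypothesis greedy_k : forall t n, n < U t -> all (fun c => c < k) (greedy U t n).

(** The valid words of length t are the greedy words of the integers below U(t), each occurring
    once. *)
Lemma sum_valid t (F : seq nat -> nat) :
  \sum_(0 <= z < k ^ t) valid U (greedy (expn k) t z) * F (greedy (expn k) t z) =
  \sum_(0 <= i < U t) F (greedy U t i).
Proof.
have hk := expn_numeration k_gt1.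
rewrite (eq_bigr (fun z => if valid U (greedy (expn k) t z) then F (greedy (expn k) t z) else 0)); last first.
  by move=> z _; case: ifP; rewrite ?mul1n ?mul0n.
rewrite -big_mkcond -big_filter -(big_map _ predT F) -[RHS](big_map _ predT F).
apply: perm_big; apply: uniq_perm.
- rewrite map_inj_in_uniq ?filter_uniq ?iota_uniq // => z z'.
  rewrite !mem_filter !mem_index_iota => /and3P[_ _ lt_z] /and3P[_ _ lt_z'] E.
  by rewrite -(wval_greedy hk lt_z) E wval_greedy.
- rewrite map_inj_in_uniq ?iota_uniq // => z z'.
  rewrite !mem_index_iota => /andP[_ lt_z] /andP[_ lt_z'] E.
  by rewrite -(wval_greedy hU lt_z) E wval_greedy.
move=> w; apply/mapP/mapP=> -[z].
  rewrite mem_filter => /andP[/andP[]]; rewrite size_greedy => lt_w /eqP Dw _ ->.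
  by exists (wval U (greedy (expn k) t z)); rewrite ?mem_index_iota.
rewrite mem_index_iota => /andP[_ lt_z] ->.
have lt_k := greedy_k lt_z.
have := greedy_expnK k_gt1 lt_k; rewrite size_greedy => Dw.
exists (wval (expn k) (greedy U t z)) => //.
rewrite mem_filter Dw valid_greedy // mem_index_iota.
by have := wval_expn_lt k_gt1 lt_k; rewrite size_greedy.
Qed.

Lemma U_sum t : U t = \sum_(0 <= z < k ^ t) valid U (greedy (expn k) t z).
Proof.
have := sum_valid t (fun=> 1); rewrite sum_nat_const_nat subn0 muln1 => <-.
by apply: eq_bigr => z _; rewrite muln1.
Qed.

Variables (D B : nat) (q0 : nat) (delta : nat -> nat -> nat -> nat) (acc : nat -> bool).

Definition run2 (q : nat) (u y : seq nat) : nat :=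
  foldl (fun q c => delta q c.1 c.2) q (zip u y).

(** The number of words [y] as long as [u] for which the pair is accepted from [q] (see [cntE]), in
    the letter by letter form that a product of matrices computes. *)
Fixpoint cnt (q : nat) (u : seq nat) : nat :=
  if u is a :: v then \sum_(0 <= b < k) cnt (delta q a b) v else acc q.

Lemma cntE q u :
  cnt q u = \sum_(0 <= z < k ^ size u) acc (run2 q u (greedy (expn k) (size u) z)).
Proof.
elim: u q => [|a u IHu] q; first by rewrite expn0 big_nat1.
rewrite (sum_greedy_cons k_gt1 (size u) (fun y => acc (run2 q (a :: u) y))) /=.
by apply: eq_bigr => b _; rewrite IHu.
Qed.

Lemma cnt_nseq0 q u :
  cnt q (nseq B 0 ++ u) =
  \sum_(0 <= z < k ^ B) cnt (run2 q (nseq B 0) (greedy (expn k) B z)) u.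
Proof.
elim: B q => [|B' IHB] q; first by rewrite expn0 big_nat1.
rewrite (sum_greedy_cons k_gt1 B' (fun y => cnt (run2 q (nseq B'.+1 0) y) u)) /=.
by apply: eq_bigr => b _; rewrite IHB.
Qed.

(** The number of words of length [B] that lead from [q0] to [q] when paired with zeros; this
    accounts for the zeros put in front of n. *)
Definition count_row (q : nat) : nat :=
  \sum_(0 <= z < k ^ B) (run2 q0 (nseq B 0) (greedy (expn k) B z) == q).

Definition count_mx (a p q : nat) : nat := \sum_(0 <= b < k) (delta p a b == q).

Hypothesis D_gt0 : 0 < D.
Hypothesis q0_lt : q0 < D.
Hypothesis delta_lt : forall q a b, delta q a b < D.

Definition count_linrep : linrep k :=
  @Linrep k D D_gt0 (\row_q Posz (count_row q))%R
    (fun a => \matrix_(p, q) Posz (count_mx a p q))%R (\col_q Posz (acc q))%R.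

Lemma run2_lt q u y : q < D -> run2 q u y < D.
Proof.
move=> lt_q; rewrite /run2; elim: (zip u y) q lt_q => //= c w IHw q _.
exact: IHw.
Qed.

Lemma sum_delta (F : nat -> nat) (p : nat) : p < D ->
  \sum_(q < D) (p == q) * F q = F p.
Proof.
move=> lt_p; rewrite (bigD1 (Ordinal lt_p)) //= eqxx mul1n big1 ?addn0 // => q.
by rewrite -val_eqE /= eq_sym => /negPf->.
Qed.

Lemma lr_morph_cnt (w : seq 'I_k) (q : 'I_D) :
  (lr_morph count_linrep w *m lr_col count_linrep)%R q ord0 =
  Posz (cnt q (digits w)).
Proof.
elim: w q => [|a w IHw] q; rewrite /lr_morph.
  by rewrite big_nil mul1mx mxE.
rewrite big_cons -mulmxA mxE /=.
rewrite (eq_bigr (fun q' : 'I_D => Posz (count_mx a q q' * cnt q' (digits w)))).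
  rewrite -(big_morph Posz PoszD (erefl (Posz 0))); congr Posz.
  rewrite /count_mx; under eq_bigr do rewrite big_distrl.
  rewrite exchange_big; apply: eq_bigr => b _.
  exact: (sum_delta (cnt^~ (digits w)) (delta_lt _ _ _)).
by move=> q' _; rewrite mxE PoszM; congr (_ * _)%R; exact: IHw.
Qed.

Lemma lr_value_cnt (w : seq 'I_k) :
  lr_value count_linrep w = Posz (cnt q0 (nseq B 0 ++ digits w)).
Proof.
rewrite /lr_value -mulmxA mxE cnt_nseq0.
rewrite (eq_bigr (fun q : 'I_D => Posz (count_row q * cnt q (digits w)))).
  rewrite -(big_morph Posz PoszD (erefl (Posz 0))); congr Posz.
  rewrite /count_row; under eq_bigr do rewrite big_distrl.
  rewrite exchange_big; apply: eq_bigr => z _.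
  by apply: (sum_delta (cnt^~ (digits w))); apply: run2_lt.
by move=> q _; rewrite mxE PoszM; congr (_ * _)%R; exact: lr_morph_cnt.
Qed.

End Count.

(** * First occurrences as representatives of the classes under reversal *)

Section FirstOccurrences.
Variables (T : finType) (x : nat -> T) (n : nat).

Lemma refl_eqv_equiv : equivalence_rel (@refl_eqv T n).
Proof.
have revK (u : n.-tuple T) : [tuple of rev [tuple of rev u]] = u.
  by apply: val_inj; rewrite /= revK.
move=> u v w; split; rewrite /refl_eqv ?eqxx // => /orP[/eqP->|/eqP->] //.
by rewrite revK orbC.
Qed.

Lemma refl_eqv_sym (u v : n.-tuple T) : refl_eqv u v = refl_eqv v u.
Proof.
apply/idP/idP => H.
  by have [uu /(_ H) <-] := refl_eqv_equiv u v u.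
by have [vv /(_ H) <-] := refl_eqv_equiv v u v.
Qed.

Definition class_of (u : n.-tuple T) : {set n.-tuple T} :=
  [set v in factors x n | refl_eqv u v].

Lemma factor_in i : factor x n i \in factors x n.
Proof. by rewrite inE; apply/asboolP; exists i. Qed.

Lemma class_first_occ_inj i j : first_occ x n i -> first_occ x n j ->
  class_of (factor x n i) = class_of (factor x n j) -> i = j.
Proof.
move=> fi fj E.
have : factor x n i \in class_of (factor x n j).
  by rewrite -E inE factor_in /refl_eqv eqxx.
rewrite inE factor_in /= => ji.
have ij : refl_eqv (factor x n i) (factor x n j) by rewrite refl_eqv_sym.
case: (ltngtP i j) => // [lt_ij | lt_ji].
  by have /forallP/(_ (Ordinal lt_ij)) := fj; rewrite /= ij.
by have /forallP/(_ (Ordinal lt_ji)) := fi; rewrite /= ji.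
Qed.

(** Each class contains the factor at exactly one first occurrence, namely the least position at
    which a member of the class occurs. *)
Lemma sum_first_occ W : (forall i, first_occ x n i -> i < W) ->
  \sum_(0 <= i < W) first_occ x n i = reflection_complexity x n.
Proof.
move=> lt_W; rewrite big_mkord /reflection_complexity.
transitivity #|[set i : 'I_W | first_occ x n i]|.
  by rewrite -sum1dep_card [RHS]big_mkcond; apply: eq_bigr => i _; case: (first_occ _ _ _).
pose g (i : 'I_W) := class_of (factor x n i).
have inj_g : {in [set i : 'I_W | first_occ x n i] &, injective g}.
  by move=> i j; rewrite !inE => fi fj /(class_first_occ_inj fi fj)/val_inj.
rewrite -(card_in_imset inj_g); apply: eq_card => S.
apply/imsetP/imsetP => [[i _ ->]|[u]].
  by exists (factor x n i); rewrite ?factor_in.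
rewrite inE => /asboolP[i0 Du] ->.
have ex_i : exists i, refl_eqv u (factor x n i) by exists i0; rewrite Du /refl_eqv eqxx.
case: (ex_minnP ex_i) => i ui min_i.
have fi : first_occ x n i.
  apply/forallP=> j; apply/negP => ji.
  have uj : refl_eqv u (factor x n j).
    by have [_ ->] := refl_eqv_equiv u (factor x n i) (factor x n j); rewrite // refl_eqv_sym.
  by have := min_i j uj; rewrite leqNgt ltn_ord.
exists (Ordinal (lt_W i fi)); first by rewrite inE.
apply/setP=> v; rewrite !inE; congr andb.
by have [_ ->] := refl_eqv_equiv u (factor x n i) v.
Qed.

(** There are finitely many words of length n, and each is the factor at no more than one first
    occurrence; the sum of these positions bounds them all. *)
Lemma first_occ_bounded : exists W, forall i, first_occ x n i -> i < W.
Proof.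
pose N (u : n.-tuple T) :=
  if pselect (exists i, first_occ x n i /\ factor x n i = u) is left h
  then projT1 (cid h) else 0.
exists (\sum_u N u).+1 => i fi.
have NE : N (factor x n i) = i.
  rewrite /N; case: pselect => [h|[]]; last by exists i.
  by case: (cid h) => j /= [fj Dj]; apply: class_first_occ_inj; rewrite ?Dj.
by rewrite ltnS (bigD1 (factor x n i)) //= NE leq_addr.
Qed.

End FirstOccurrences.

(** * The length of first occurrences *)

Section Bound.
Variables (U : nat -> nat) (hU : numeration_system U) (k' : nat).
Local Notation k := k'.+1.
Hypothesis greedy_k : forall t n, n < U t -> all (fun c => c < k) (greedy U t n).
Variables (T : finType) (x : nat -> T) (D : nat).
Local Notation fst_tr w := (map (fun c : 'I_k * 'I_k => val c.1) w).
Local Notation snd_tr w := (map (fun c : 'I_k * 'I_k => val c.2) w).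
Hypothesis RD : recog D
  (fun w : seq ('I_k * 'I_k) => [&& valid U (fst_tr w), valid U (snd_tr w) &
     first_occ x (wval U (fst_tr w)) (wval U (snd_tr w))]).

Definition pair_word (u y : seq nat) : seq ('I_k * 'I_k) :=
  zip (map inord u) (map inord y).

Lemma pair_wordE u y : size u = size y ->
  all (fun c => c < k) u -> all (fun c => c < k) y ->
  fst_tr (pair_word u y) = u /\ snd_tr (pair_word u y) = y.
Proof.
elim: u y => [|a u IHu] [|b y] //= [eq_sz] /andP[lt_a lt_u] /andP[lt_b lt_y].
by have [E1 E2] := IHu y eq_sz lt_u lt_y; rewrite !inordK // E1 E2.
Qed.

(* Pumping at the leading zeros of [n] turns an occurrence that is too long into
   a longer one, but the first occurrences are bounded. *)
Lemma len_first_occ n i : first_occ x n i -> len U i <= len U n + D.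
Proof.
have [W ltW] := first_occ_bounded x n.
have [d] := ubnP (W - i); elim: d i => // d IHd i lt_d fi.
rewrite leqNgt; apply/negP => lt_len.
suff [i' lt_i' fi'] : exists2 i', i < i' & first_occ x n i'.
  have := IHd i' _ fi'; have := ltW _ fi'.
  have : len U i <= len U i'.
    by rewrite (len_leq hU) (ltn_trans lt_i') ?ltn_U_len.
  lia.
have [Q [q0 [e [F [DQ HF]]]]] := RD.
pose t := len U i; have lt_i : i < U t by exact: ltn_U_len.
have lt_n : n < U t by rewrite -(len_leq hU) /t; lia.
pose z := t - len U n.
pose c := head 0 (rep U i); pose y := behead (rep U i).
have Di : greedy U t i = c :: y.
  have : size (greedy U t i) = t by exact: size_greedy.
  rewrite /c /y -/(greedy U t i) -[rep U i]/(greedy U t i).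
  by case: (greedy U t i) => //= E; move: lt_len; rewrite -/t -E; lia.
have c_gt0 : 0 < c.
  have := head_rep hU i; rewrite -[rep U i]/(greedy U t i) Di.
  by rewrite /= lt0n.
have Dn : greedy U t n = nseq z 0 ++ rep U n.
  rewrite (greedy_pad hU lt_n) /pad size_rep; congr (nseq _ _ ++ _).
pose u := behead (greedy U t n).
have Dz : z = z.-1.+1 by rewrite /z; lia.
have Du : greedy U t n = 0 :: u by rewrite /u Dn Dz.
have [sz_u sz_y] : size u = t.-1 /\ size y = t.-1.
  by rewrite /u /y !size_behead size_greedy size_rep.
have := greedy_k lt_n; have := greedy_k lt_i; rewrite Du Di => /andP[lt_c lt_y] /andP[_ lt_u].
have [E1 E2] := pair_wordE (etrans sz_u (esym sz_y)) lt_u lt_y.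
set w := pair_word u y in E1 E2.
(* The first letter carries the nonzero leading digit of i and is kept out of the pumped part, so
   that lengthening the rest increases the second value. *)
pose s0 : 'I_k * 'I_k := (ord0, inord c).
have [w1 [w2 [w3 [Dw w2_gt0 Dq]]]] : exists w1 w2 w3,
    [/\ take D w = w1 ++ w2 ++ w3, 0 < size w2
      & foldl e (e q0 s0) (w1 ++ w2) = foldl e (e q0 s0) w1].
  apply: foldl_pump; rewrite DQ size_take size_zip !size_map sz_u sz_y minnn.
  by case: ifP => //; rewrite /t; lia.
have Dw' : w = w1 ++ w2 ++ w3 ++ drop D w by rewrite -[LHS](cat_take_drop D) Dw -!catA.
pose w' := s0 :: w1 ++ w2 ++ w2 ++ w3 ++ drop D w.
have Fw' : F (foldl e q0 w').
  have -> : foldl e q0 w' = foldl e q0 (s0 :: w).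
    by rewrite Dw' /w' /= catA 2!foldl_cat Dq -!foldl_cat catA foldl_cat Dq -foldl_cat.
  have G1 : fst_tr (s0 :: w) = greedy U t n by rewrite Du -E1.
  have G2 : snd_tr (s0 :: w) = greedy U t i by rewrite Di -E2 /= inordK.
  by rewrite HF G1 G2 !valid_greedy // !wval_greedy.
move: Fw'; rewrite HF => /and3P[vn vi fi'].
have Dn' : wval U (fst_tr w') = n.
  (* The [D] letters after the first one lie within the padding of n, so repeating [w2] there
     inserts only zeros in front of n. *)
  have le_D : D <= z.-1 by rewrite /z /t; lia.
  have D0 : fst_tr (w1 ++ w2 ++ w3) = nseq D 0.
    rewrite -Dw map_take E1 /u Dn Dz /= take_cat size_nseq.
    by case: ltnP => [_|le_z]; rewrite ?take_nseq // (_ : D - _ = 0) ?take0 ?cats0; [congr nseq|]; lia.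
  have Z v : all (pred1 0) (fst_tr v) -> forall v', wval U (fst_tr v ++ v') = wval U v'.
    by move=> /all_pred1P -> v'; rewrite wval_nseq0.
  have : all (pred1 0) (fst_tr (w1 ++ w2 ++ w3)) by rewrite D0 all_nseq /= orbT.
  rewrite !map_cat !all_cat => /and3P[Z1 Z2 Z3].
  rewrite /w' /= mul0n add0n !map_cat !Z //.
  transitivity (wval U (fst_tr w)); first by rewrite [in RHS]Dw' !map_cat !Z.
  by rewrite E1 -[wval U u]/(0 * U (size u) + wval U u) -/(wval U (0 :: u)) -Du wval_greedy.
exists (wval U (snd_tr w')); last by rewrite -[n]Dn'.
(* Behind [s0] there are now at least t letters, so the digit c > 0 alone contributes at least U(t)
   > i. *)
rewrite (leq_trans lt_i) // /w' /= inordK //.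
apply: leq_trans (leq_addr _ _); apply: leq_trans (leq_pmull _ c_gt0).
rewrite leq_U // size_map !size_cat; move: (congr1 size Dw').
by rewrite !size_cat size_zip !size_map sz_u sz_y minnn; lia.
Qed.

End Bound.

(** * Tables of automata *)

(** Turns the run of an automaton on a word into a primitive recursion over the positions of its
    letters. *)
Lemma prec_mkseq (S : Type) (f : nat -> S -> nat) (g : nat -> S) q t :
  prec q (fun j y => f y (g j)) t = foldl f q (mkseq g t).
Proof. by elim: t => // t IHt; rewrite mkseqS -cats1 foldl_cat -IHt. Qed.

Section Tables.
Variables (D k' : nat).
Local Notation k := k'.+1.
Hypothesis D_gt1 : 1 < D.
Local Notation fst_tr w := (map (fun c : 'I_k * 'I_k => val c.1) w).
Local Notation snd_tr w := (map (fun c : 'I_k * 'I_k => val c.2) w).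

(* A number [z < D ^ tab_size] encodes, by its digits in base [D], an automaton
   with the states [0, ..., D - 1]: transitions, final states, initial state. *)
Definition tab_size : nat := D * (k * k) + D + 1.
Definition tab (z j : nat) : nat := greedy_digit (expn D) tab_size z j.
(** The reduction modulo [D] yields a state for all arguments whatsoever, as [count_linrep]
    requires. *)
Definition tab_delta (z q a b : nat) : nat := tab z (q * (k * k) + (a * k + b)) %% D.
Definition tab_acc (z q : nat) : bool := tab z (D * (k * k) + q) != 0.
Definition tab_init (z : nat) : nat := tab z (D * (k * k) + D) %% D.
Definition tab_run (z : nat) (u y : seq nat) : bool :=
  tab_acc z (run2 (tab_delta z) (tab_init z) u y).

Lemma run2_foldl (delta : nat -> nat -> nat -> nat)
    (e : 'I_D -> 'I_k * 'I_k -> 'I_D) (w : seq ('I_k * 'I_k)) q :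
  (forall q c, delta (val q) (val c.1) (val c.2) = val (e q c)) ->
  run2 delta (val q) (fst_tr w) (snd_tr w) = val (foldl e q w).
Proof.
move=> He; rewrite /run2; elim: w q => //= c w IHw q.
by rewrite He IHw.
Qed.

Lemma tab_exists (q0 : 'I_D) (e : 'I_D -> 'I_k * 'I_k -> 'I_D) (F : pred 'I_D) :
  exists2 z, z < D ^ tab_size &
    forall w, tab_run z (fst_tr w) (snd_tr w) = F (foldl e q0 w).
Proof.
have k2_gt0 : 0 < k * k by [].
(* The intended entries of the table: the divisions recover state and letters from the index used in
   [tab_delta]. *)
pose f j : nat :=
  if j < D * (k * k) then
    val (e (insubd q0 (j %/ (k * k))) (inord (j %% (k * k) %/ k), inord (j %% (k * k) %% k)))
  else if j < D * (k * k) + D then F (insubd q0 (j - D * (k * k))) : nat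
  else val q0.
pose s := mkseq f tab_size.
have lt_s : all (fun d => d < D) s.
  apply/allP=> _ /mapP[j _ ->]; rewrite /f; case: ifP => _; first exact: ltn_ord.
  by case: ifP => _; [case: (F _); rewrite // ltnW | exact: ltn_ord].
have tabE j : j < tab_size -> tab (wval (expn D) s) j = f j.
  move=> lt_j; have := greedy_expnK D_gt1 lt_s.
  rewrite size_mkseq greedyE => /(congr1 (fun s' => nth 0 s' j)).
  by rewrite !nth_mkseq.
exists (wval (expn D) s).
  by have := wval_expn_lt D_gt1 lt_s; rewrite size_mkseq.
move=> w; rewrite /tab_run.
have -> : tab_init (wval (expn D) s) = val q0.
  rewrite /tab_init tabE ?ltnn /tab_size ?addn1 // /f ltnn ltnNge leq_addr /=.
  by rewrite modn_small.
rewrite (run2_foldl (e := e)) => [|q c].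
  rewrite /tab_acc tabE; last by rewrite /tab_size addn1 ltnS leq_add2l; apply/ltnW/ltn_ord.
  rewrite /f ltnNge leq_addr /= ltn_add2l ltn_ord addKn valKd.
  by case: (F _).
have lt_c : c.1 * k + c.2 < k * k by move: (ltn_ord c.1) (ltn_ord c.2); nia.
have lt_j : q * (k * k) + (c.1 * k + c.2) < D * (k * k).
  by have := ltn_ord q; nia.
rewrite /tab_delta tabE; last first.
  by rewrite /tab_size -addnA; apply: leq_trans lt_j (leq_addr _ _).
rewrite /f lt_j divnMDl // divn_small // addn0 modnMDl (modn_small lt_c).
rewrite divnMDl // divn_small ?ltn_ord // addn0 modnMDl (modn_small (ltn_ord c.2)).
rewrite valKd !inord_val [LHS]modn_small ?ltn_ord //.
by case: c {lt_c lt_j}.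
Qed.

Lemma tab_agree z (q0 : 'I_D) (e : 'I_D -> 'I_k * 'I_k -> 'I_D) (F : pred 'I_D) :
  (forall w, size w < D * D ->
     tab_run z (fst_tr w) (snd_tr w) = F (foldl e q0 w)) ->
  forall w, tab_run z (fst_tr w) (snd_tr w) = F (foldl e q0 w).
Proof.
have D_gt0 : 0 < D by exact: ltnW.
pose p0 : 'I_D := Ordinal (ltn_pmod (tab z (D * (k * k) + D)) D_gt0).
pose ez (q : 'I_D) (c : 'I_k * 'I_k) : 'I_D :=
  Ordinal (ltn_pmod (tab z (q * (k * k) + (c.1 * k + c.2))) D_gt0).
have E w : tab_run z (fst_tr w) (snd_tr w) = tab_acc z (val (foldl ez p0 w)).
  by rewrite /tab_run -[tab_init z]/(val p0) (run2_foldl (e := ez)).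
move=> H w; rewrite E.
apply: (dfa_eq (F1 := fun q => tab_acc z (val q)) (F2 := F)) => v.
by rewrite !card_ord => lt_v; rewrite -E H.
Qed.

End Tables.

(** * Entries of flattened tables and matrices *)

Section Coding.

Lemma nth_allpairs (S R V : Type) (f : S -> R -> V) s t x0 y0 z0 i j :
  i < size s -> j < size t ->
  nth z0 [seq f x y | x <- s, y <- t] (i * size t + j) = f (nth x0 s i) (nth y0 t j).
Proof.
elim: s i => //= x s IHs [|i] lt_i lt_j; rewrite nth_cat size_map.
  by rewrite mul0n lt_j (nth_map y0).
by rewrite mulSn -addnA ltnNge leq_addr /= addKn IHs.
Qed.

Lemma nth_table m n (f : 'I_m -> 'I_n -> nat) (s : seq nat) (q : 'I_m) (d : 'I_n) :
  nth 0 ([seq f q d | q <- enum 'I_m, d <- enum 'I_n] ++ s) (q * n + d) = f q d.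
Proof.
have lt_q := ltn_ord q; have lt_d := ltn_ord d.
rewrite nth_cat size_allpairs !size_enum_ord ifT; last by nia.
rewrite -[X in _ * X]size_enum_ord (nth_allpairs _ q d) ?size_enum_ord //.
by rewrite !nth_ord_enum.
Qed.

Lemma flatten_mkseq (V : Type) (f : nat -> nat -> V) m n :
  flatten (mkseq (fun i => mkseq (f i) n) m) =
  mkseq (fun l => f (l %/ n) (l %% n)) (m * n).
Proof.
rewrite [mkseq _ m]/mkseq; elim: m => [|m IHm]; first by rewrite mul0n.
rewrite -addn1 iotaD map_cat flatten_cat IHm /= cats0 mulnDl mul1n.
rewrite /mkseq iotaD map_cat; congr (_ ++ _).
have -> : iota (0 + m * n) n = map (addn (m * n)) (iota 0 n).
  by rewrite -iotaDl addn0.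
rewrite -map_comp; apply/eq_in_map => j.
rewrite mem_iota => /= lt_j; have n_gt0 : 0 < n by lia.
by rewrite divnMDl // divn_small // addn0 modnMDl modn_small.
Qed.

Lemma map_enum_ord (V : Type) (f : nat -> V) n :
  [seq f (val i) | i <- enum 'I_n] = mkseq f n.
Proof. by rewrite /mkseq -val_enum_ord -map_comp. Qed.

(** The factor 2 comes from [int_code], which sends nonnegative integers to even numbers. *)
Lemma mx_codeE m n (f : nat -> nat -> nat) :
  mx_code (\matrix_(i < m, j < n) Posz (f i j))%R =
  mkseq (fun l => 2 * f (l %/ n) (l %% n)) (m * n).
Proof.
rewrite /mx_code -(flatten_mkseq (fun i j => 2 * f i j)).
rewrite -(map_enum_ord (fun i => mkseq (fun j => 2 * f i j) n)).
congr flatten; apply: eq_map => i.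
rewrite -(map_enum_ord (fun j => 2 * f i j)); apply: eq_map => j.
by rewrite mxE /= mul2n.
Qed.

End Coding.

(** * The algorithm *)

Lemma mkseqS_head (V : Type) (f : nat -> V) t :
  mkseq f t.+1 = f 0 :: mkseq (fun j => f j.+1) t.
Proof. by rewrite /mkseq /= (iotaDl 1 0) -map_comp. Qed.

Lemma wval_mkseq U f t :
  wval U (mkseq f t) = \sum_(0 <= j < t) f j * U (t - j.+1).
Proof.
elim: t f => [|t IHt] f; first by rewrite big_nil.
by rewrite mkseqS_head big_nat_recl //= size_mkseq IHt subn1.
Qed.

Lemma RE_greedy_digit (V : nat -> nat) :
  (forall f, RE f -> RE (fun v => V (f v))) -> forall f g h,
  RE f -> RE g -> RE h -> RE (fun v => greedy_digit V (f v) (g v) (h v)).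
Proof.
move=> HV f g h; apply: (RE_comp3 (f := greedy_digit V)); rewrite /greedy_digit.
by re; apply: HV; re.
Qed.

Lemma RE_expn_digit b f g h : RE b -> RE f -> RE g -> RE h ->
  RE (fun v => greedy_digit (expn (b v)) (f v) (g v) (h v)).
Proof.
apply: (RE_comp4 (f := fun b => greedy_digit (expn b))).
by rewrite /greedy_digit; re.
Qed.

Ltac re_user ::=
  lazymatch goal with
  | |- RE (fun v => code_nth (@?f v) (@?g v)) => refine (@RE_code_nth f g _ _)
  | |- RE (fun v => greedy_digit (expn (@?b v)) (@?f v) (@?g v) (@?h v)) =>
      refine (@RE_expn_digit b f g h _ _ _ _)
  | |- RE (fun v => code_cat (@?f v) (@?n v) (@?c v)) =>
      refine (@RE_code_cat (fun i v => f v i) n c _ _ _)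
  end.

Section Program.
Variables (U : nat -> nat) (hU : numeration_system U) (k' : nat).
Local Notation k := k'.+1.
Variable M : dfao ('I_k * 'I_k * 'I_k)%type bool.
Hypothesis adderP : forall w : seq (nat * nat * nat),
    (exists2 w', digits3 w' = w & run M w') <->
    (exists a b c : nat, a + b = c /\ w = pad3 (rep U a) (rep U b) (rep U c)).
Local Notation a := (dfao_states M).+1.
Local Notation fst_tr w := (map (fun c : 'I_k * 'I_k => val c.1) w).
Local Notation snd_tr w := (map (fun c : 'I_k * 'I_k => val c.2) w).

Let greedy_k t n : n < U t -> all (fun c => c < k) (greedy U t n).
Proof. exact: (greedy_lt hU adderP). Qed.

Lemma k_gt1 : 1 < k.
Proof.
have := greedy_k (ltn_id_U hU 1); by rewrite /= U0 // divn1 andbT.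
Qed.

Definition valid_num (t w : nat) : bool :=
  (w < k ^ t) && valid U (greedy (expn k) t w).

(** The automaton for validity depends on [U] and its adder alone, so its transitions and final
    states are constants [cT] and [cF] of the program. Mere existence of these numbers is enough. *)
Lemma RE_valid_num f g : RE f -> RE g -> RE (fun v => valid_num (f v) (g v)).
Proof.
apply: (RE_comp2 (f := fun t w => valid_num t w : nat)).
have [v0 [e [F HF]]] := recog_ord (recog_valid hU adderP).
have [cT HT] : exists cT, forall q d, code_nth cT (val q * k + val d) = val (e q d).
  exists (CodeSeq.code ([seq val (e q d) | q <- enum 'I_a, d <- enum 'I_k] ++ [::])).
  move=> q d; rewrite code_nthE ?nth_table // cats0 size_allpairs !size_enum_ord.
  by move: (ltn_ord q) (ltn_ord d) => /=; nia.
have [cF HcF] : exists cF, forall q, code_nth cF (val q) = F q.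
  exists (CodeSeq.code (mkseq (fun q => F (insubd v0 q) : nat) a)) => q.
  by rewrite code_nthE ?size_mkseq ?ltn_ord // nth_mkseq ?ltn_ord // valKd.
have HeT (u : seq 'I_k) q :
    foldl (fun y d => code_nth cT (y * k + d)) (val q) (map val u) = val (foldl e q u).
  by elim: u q => //= d u IHu q; rewrite HT IHu.
pose st t w := prec (val v0)
  (fun j y => code_nth cT (y * k + greedy_digit (expn k) t w j)) t.
have stE t w : w < k ^ t ->
    code_nth cF (st t w) = valid U (greedy (expn k) t w).
  move=> lt_w; have lt_d := greedy_expn_lt k_gt1 lt_w.
  rewrite /st (prec_mkseq (fun y d => code_nth cT (y * k + d))) -greedyE.
  have Dw : greedy (expn k) t w = map val [seq inord d : 'I_k | d <- greedy (expn k) t w].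
    rewrite -map_comp -[LHS]map_id; apply/eq_in_map => d /(allP lt_d) lt_dk /=.
    by rewrite inordK.
  by rewrite Dw -HF -HcF HeT.
apply: (RE_ext (f := fun v => (nth 0 v 1 < k ^ nth 0 v 0) &&
   (code_nth cF (st (nth 0 v 0) (nth 0 v 1)) == 1))).
  move=> v; rewrite /valid_num; case: ltnP => //= lt_w; rewrite stE //.
  by case: (valid _ _).
by rewrite /st; re.
Qed.

Lemma RE_U f : RE f -> RE (fun v => U (f v)).
Proof.
apply: RE_comp1.
apply: (RE_ext (f := fun v => \sum_(0 <= z < k ^ nth 0 v 0) valid_num (nth 0 v 0) z)).
  move=> v; rewrite [RHS](U_sum hU k_gt1 greedy_k); apply: eq_big_nat => z /= lt_z.
  by rewrite /valid_num lt_z.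
by re; exact: RE_valid_num (RE_behead (RE_nth 0)) (RE_nth 0).
Qed.

Definition code_dim (c : nat) : nat := occ_dim a (code_nth c 1).

Definition lenU (n : nat) : nat := \sum_(0 <= t < n.+1) (U t <= n).

(** The rank of the letter x(n), obtained by running the coded DFAO. The offset 3 skips the header
    of [dfao_code]; the outputs come after the transitions, one for each state and digit. *)
Definition code_seq (c n : nat) : nat :=
  code_nth c (3 + (code_nth c 1 * code_nth c 0 +
    prec (code_nth c 2) (fun j y =>
      code_nth c (3 + (y * code_nth c 0 + greedy_digit U (lenU n) n j))) (lenU n))).

Definition code_occ (c n i : nat) : bool :=
  all (fun j =>
    ~~ all (fun l => code_seq c (i + l) == code_seq c (j + l)) (iota 0 n) &&
    ~~ all (fun l => code_seq c (i + l) == code_seq c (j + (n - l.+1))) (iota 0 n))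
    (iota 0 i).

Definition valk (t w : nat) : nat :=
  \sum_(0 <= j < t) greedy_digit (expn k) t w j * U (t - j.+1).

Definition code_lang (c t w1 w2 : nat) : bool :=
  valid_num t w1 && (valid_num t w2 && code_occ c (valk t w1) (valk t w2)).

Definition code_run (c z t w1 w2 : nat) : bool :=
  tab_acc (code_dim c) k' z (prec (tab_init (code_dim c) k' z) (fun j y =>
    tab_delta (code_dim c) k' z y (greedy_digit (expn k) t w1 j)
      (greedy_digit (expn k) t w2 j)) t).

Definition code_good (c z : nat) : bool :=
  all (fun t => all (fun w1 => all (fun w2 =>
    (code_run c z t w1 w2 : nat) == (code_lang c t w1 w2 : nat))
    (iota 0 (k ^ t))) (iota 0 (k ^ t))) (iota 0 (code_dim c * code_dim c)).

Definition code_tab (c : nat) : nat :=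
  search (code_good c) (code_dim c ^ tab_size (code_dim c) k').

Definition code_row (c q : nat) : nat :=
  \sum_(0 <= w < k ^ code_dim c)
    (prec (tab_init (code_dim c) k' (code_tab c)) (fun j y =>
       tab_delta (code_dim c) k' (code_tab c) y 0
         (greedy_digit (expn k) (code_dim c) w j)) (code_dim c) == q).

Definition code_mx (c d p q : nat) : nat :=
  \sum_(0 <= b < k) (tab_delta (code_dim c) k' (code_tab c) p d b == q).

(** The two outer layers 2 ^ _ * (2 * _).+1 are the cons steps of [CodeSeq.code] for the alphabet
    size and the dimension. The factors 1 and the division by 1 keep the shape of [mx_codeE] for row
    and column vectors. *)
Definition code_linrep (c : nat) : nat :=
  2 ^ k * (2 * (2 ^ code_dim c * (2 *
    code_cat (fun l => 2 * code_row c (l %% code_dim c)) (1 * code_dim c)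
    (code_cat (fun l => 2 * code_mx c (l %/ (code_dim c * code_dim c))
        (l %% (code_dim c * code_dim c) %/ code_dim c)
        (l %% (code_dim c * code_dim c) %% code_dim c))
      (k * (code_dim c * code_dim c))
    (code_cat (fun l => 2 * tab_acc (code_dim c) k' (code_tab c) (l %/ 1))
      (code_dim c * 1) 0))).+1)).+1.

Lemma RE_tab D f g : RE D -> RE f -> RE g -> RE (fun v => tab (D v) k' (f v) (g v)).
Proof. by apply: (RE_comp3 (f := fun D => tab D k')); rewrite /tab /tab_size; re. Qed.

Lemma RE_code_dim f : RE f -> RE (fun v => code_dim (f v)).
Proof. by apply: RE_comp1; rewrite /code_dim /occ_dim /neq_dim; re. Qed.

Ltac re_user ::=
  lazymatch goal with
  | |- RE (fun v => U (@?f v)) => refine (@RE_U f _)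
  | |- RE (fun v => greedy_digit U (@?f v) (@?g v) (@?h v)) =>
      refine (@RE_greedy_digit U RE_U f g h _ _ _)
  | |- RE (fun v => code_nth (@?f v) (@?g v)) => refine (@RE_code_nth f g _ _)
  | |- RE (fun v => greedy_digit (expn (@?b v)) (@?f v) (@?g v) (@?h v)) =>
      refine (@RE_expn_digit b f g h _ _ _ _)
  | |- RE (fun v => code_cat (@?f v) (@?n v) (@?c v)) =>
      refine (@RE_code_cat (fun i v => f v i) n c _ _ _)
  | |- RE (fun v => tab (@?d v) k' (@?f v) (@?g v)) => refine (@RE_tab d f g _ _ _)
  | |- RE (fun v => code_dim (@?f v)) => refine (@RE_code_dim f _)
  | |- RE (fun v => nat_of_bool (valid_num (@?f v) (@?g v))) => refine (@RE_valid_num f g _ _)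
  end.

Lemma RE_code_tab f : RE f -> RE (fun v => code_tab (f v)).
Proof.
apply: RE_comp1; rewrite /code_tab /code_good /code_run /code_lang.
rewrite /code_occ /code_seq /lenU /valk /tab_acc /tab_init /tab_delta /tab_size.
by re.
Qed.

Lemma computable_code_linrep : computable code_linrep.
Proof.
have H : RE (fun v => code_linrep (nth 0 v 0)).
  rewrite /code_linrep /code_row /code_mx /tab_acc /tab_init /tab_delta.
  by re; apply: RE_code_tab; re.
by apply: eq_recursive (H 1) => v; rewrite /thead (tnth_nth 0).
Qed.

End Program.

(** * Correctness of the algorithm *)

Section Correctness.
Variables (U : nat -> nat) (hU : numeration_system U) (k' : nat).
Local Notation k := k'.+1.
Variable M : dfao ('I_k * 'I_k * 'I_k)%type bool.
Hypothesis adderP : forall w : seq (nat * nat * nat),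
    (exists2 w', digits3 w' = w & run M w') <->
    (exists a b c : nat, a + b = c /\ w = pad3 (rep U a) (rep U b) (rep U c)).
Variables (T : finType) (x : nat -> T) (K : nat) (A : dfao 'I_K T).
Hypothesis Ax : generates U A x.
Local Notation m := (dfao_states A).
Local Notation a := (dfao_states M).+1.
Local Notation c := (dfao_code A).
Local Notation fst_tr w := (map (fun c : 'I_k * 'I_k => val c.1) w).
Local Notation snd_tr w := (map (fun c : 'I_k * 'I_k => val c.2) w).

Lemma code_nth_header :
  [/\ code_nth c 0 = K, code_nth c 1 = m & code_nth c 2 = val (dfao_init A)].
Proof. by split; rewrite /dfao_code code_nthE. Qed.

Lemma code_nth_trans (q : 'I_m) (d : 'I_K) :
  code_nth c (3 + (q * K + d)) = val (dfao_trans q d).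
Proof.
rewrite /dfao_code code_nthE.
  by rewrite nth_cat /= addKn nth_table.
rewrite !size_cat /= ltn_add2l size_allpairs !size_enum_ord ltn_addr //.
apply: (@leq_trans (q.+1 * K)); last by rewrite leq_mul2r ltn_ord orbT.
by rewrite mulSn addnC ltn_add2r.
Qed.

Lemma code_nth_out (q : 'I_m) :
  code_nth c (3 + (m * K + q)) = val (enum_rank (dfao_out q)).
Proof.
have sz : size [seq val (dfao_trans q d) | q <- enum 'I_m, d <- enum 'I_K] = m * K.
  by rewrite size_allpairs !size_enum_ord.
rewrite /dfao_code code_nthE.
  rewrite nth_cat /= addKn nth_cat sz ltnNge leq_addr /= addKn.
  by rewrite (nth_map q) ?size_enum_ord // nth_ord_enum.
by rewrite !size_cat /= !ltn_add2l sz ltn_add2l size_map size_enum_ord.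
Qed.

Lemma lenUE n : lenU U n = len U n.
Proof.
rewrite /lenU (eq_bigr (fun t => (t < len U n) : nat)) => [|t _]; last first.
  by rewrite [t < _]ltnNge (len_leq hU) -leqNgt.
have le_n : len U n <= n.+1 by rewrite (len_leq hU) (ltn_trans _ (ltn_id_U hU _)).
rewrite -[RHS](minn_idPl le_n); elim: n.+1 => [|N IHN]; first by rewrite big_geq ?minn0.
by rewrite big_nat_recr //= IHN; case: ltnP; lia.
Qed.

Lemma code_seqE n : code_seq U c n = val (enum_rank (x n)).
Proof.
have [E0 E1 E2] := code_nth_header.
rewrite /code_seq E0 E1 E2 lenUE.
rewrite (prec_mkseq (fun y d => code_nth c (3 + (y * K + d)))) -greedyE.
rewrite -[greedy _ _ _]/(rep U n); have [w <- ->] := Ax n.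
rewrite -code_nth_out; congr (code_nth _ (3 + (_ + _))).
by rewrite /digits; elim: w (dfao_init A) => //= d w IHw q; rewrite code_nth_trans IHw.
Qed.

Lemma code_occE n i : code_occ U c n i = first_occ x n i.
Proof.
have seq_eq p q : (code_seq U c p == code_seq U c q) = (x p == x q).
  by rewrite !code_seqE val_eqE (inj_eq enum_rank_inj).
have allE (f g : nat -> nat) : all (fun l => code_seq U c (f l) == code_seq U c (g l)) (iota 0 n)
    = `[< forall l, l < n -> x (f l) = x (g l) >].
  apply/allP/asboolP => E l.
    by move=> lt_l; apply/eqP; rewrite -seq_eq E // mem_iota.
  by rewrite mem_iota => /E Dl; rewrite seq_eq Dl.
rewrite /code_occ; apply/allP/forallP => [H j | H j].
  have := H j; rewrite mem_iota ltn_ord !allE => /(_ isT)/andP[/asboolPn N1 /asboolPn N2].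
  by apply/orP=> -[/factor_eqP|/factor_revP].
rewrite mem_iota /= => lt_j; have := H (Ordinal lt_j); rewrite !allE negb_or => /andP[N1 N2].
by apply/andP; split; apply/asboolPn => E; [case/factor_eqP: N1 | case/factor_revP: N2].
Qed.

Lemma valkE t w : valk U k' t w = wval U (greedy (expn k) t w).
Proof. by rewrite greedyE wval_mkseq. Qed.

Let k_gt1 : 1 < k := k_gt1 hU adderP.
Let greedy_k t n : n < U t -> all (fun c => c < k) (greedy U t n).
Proof. exact: (greedy_lt hU adderP). Qed.

Definition occ_lang (u y : seq nat) : bool :=
  [&& valid U u, valid U y & first_occ x (wval U u) (wval U y)].

Lemma recog_occ_lang : recog (occ_dim a m)
  (fun w : seq ('I_k * 'I_k) => occ_lang (fst_tr w) (snd_tr w)).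
Proof. exact: recog_first_occ. Qed.

Lemma code_dimE : code_dim M c = occ_dim a m.
Proof. by rewrite /code_dim; have [_ -> _] := code_nth_header. Qed.

(** The adder has an initial state, so [a] is at least 2. The bound is needed because tables are
    written in base [D]. *)
Lemma code_dim_gt1 : 1 < code_dim M c.
Proof.
have a_gt1 : 1 < a by rewrite ltnS (leq_ltn_trans _ (ltn_ord (dfao_init M))).
rewrite code_dimE /occ_dim; set e := 2 ^ _.
have : 0 < e by rewrite expn_gt0.
by move: a_gt1; nia.
Qed.

(* The number of states is huge and must not be unfolded. *)
Variable D : nat.
Hypothesis DE : code_dim M c = D.

Let D_gt1 : 1 < D. Proof. by rewrite -DE code_dim_gt1. Qed.

Lemma code_runE z t w1 w2 :
  code_run M c z t w1 w2 =
  tab_run D k' z (greedy (expn k) t w1) (greedy (expn k) t w2).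
Proof.
rewrite /code_run /tab_run DE; congr tab_acc.
rewrite (prec_mkseq (fun y d => tab_delta D k' z y d.1 d.2)
  (fun j => (greedy_digit (expn k) t w1 j, greedy_digit (expn k) t w2 j))).
rewrite /run2 !greedyE; congr foldl.
by rewrite /mkseq; elim: (iota 0 t) => //= j s ->.
Qed.

Lemma code_langE t w1 w2 : w1 < k ^ t -> w2 < k ^ t ->
  code_lang U k' c t w1 w2 =
  occ_lang (greedy (expn k) t w1) (greedy (expn k) t w2).
Proof.
by move=> lt1 lt2; rewrite /code_lang /valid_num lt1 lt2 !valkE code_occE.
Qed.

Lemma code_goodP z :
  code_good U M c z <->
  (forall w, size w < D * D ->
     tab_run D k' z (fst_tr w) (snd_tr w) = occ_lang (fst_tr w) (snd_tr w)).
Proof.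
rewrite /code_good DE; split=> [H w lt_w | H].
  have trE (f : 'I_k * 'I_k -> nat) : (forall s, f s < k) ->
      wval (expn k) (map f w) < k ^ size w /\
      greedy (expn k) (size w) (wval (expn k) (map f w)) = map f w.
    move=> lt_f; have lt_m : all (fun d => d < k) (map f w).
      by apply/allP=> _ /mapP[s _ ->].
    by have := greedy_expnK k_gt1 lt_m; have := wval_expn_lt k_gt1 lt_m; rewrite size_map.
  have [lt1 E1] := trE (fun s => val s.1) (fun s => ltn_ord _).
  have [lt2 E2] := trE (fun s => val s.2) (fun s => ltn_ord _).
  move/allP/(_ (size w)): H; rewrite mem_iota => /(_ lt_w).
  move/allP/(_ (wval (expn k) (fst_tr w))); rewrite mem_iota => /(_ lt1).
  move/allP/(_ (wval (expn k) (snd_tr w))); rewrite mem_iota => /(_ lt2).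
  rewrite code_runE code_langE // E1 E2.
  by case: (tab_run _ _ _ _ _); case: (occ_lang _ _).
apply/allP=> t; rewrite mem_iota add0n => /andP[_ lt_t].
apply/allP=> w1; rewrite mem_iota add0n => /andP[_ lt1].
apply/allP=> w2; rewrite mem_iota add0n => /andP[_ lt2].
rewrite code_runE code_langE //.
have [E1 E2] := pair_wordE (etrans (size_greedy _ t w1) (esym (size_greedy _ t w2)))
  (greedy_expn_lt k_gt1 lt1) (greedy_expn_lt k_gt1 lt2).
have := H (pair_word k' (greedy (expn k) t w1) (greedy (expn k) t w2)).
by rewrite E1 E2 => ->; rewrite // -(size_map (fun s => val s.1)) E1 size_greedy.
Qed.

Let recog_D :
  recog D (fun w : seq ('I_k * 'I_k) => occ_lang (fst_tr w) (snd_tr w)).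
Proof. by rewrite -DE code_dimE; exact: recog_occ_lang. Qed.

Local Notation z := (code_tab U M c).

Lemma code_tabP w :
  tab_run D k' z (fst_tr w) (snd_tr w) = occ_lang (fst_tr w) (snd_tr w).
Proof.
have [q0 [e [F HF]]] := recog_ord recog_D.
have [z0 lt_z0 Hz0] := @tab_exists D k' D_gt1 q0 e F.
have good0 : code_good U M c z0.
  by apply/code_goodP => v _; rewrite Hz0 HF.
have [_ good_z] : z < D ^ tab_size D k' /\ code_good U M c z.
  by rewrite /code_tab DE; apply: searchP lt_z0 good0.
move/code_goodP: good_z => good_z; rewrite -HF.
by apply: (@tab_agree D k' D_gt1) => v lt_v; rewrite HF good_z.
Qed.

Lemma tab_runP u y : size u = size y ->
  all (fun c => c < k) u -> all (fun c => c < k) y ->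
  tab_run D k' z u y = occ_lang u y.
Proof.
move=> eq_sz lt_u lt_y; have [E1 E2] := pair_wordE eq_sz lt_u lt_y.
by have := code_tabP (pair_word k' u y); rewrite E1 E2.
Qed.

Let D_gt0 : 0 < D := ltnW D_gt1.

Definition occ_linrep : linrep k :=
  count_linrep k D (tab_init D k' z) (tab_delta D k' z) (tab_acc D k' z) D_gt0.

Lemma occ_linrep_represents :
  represents U occ_linrep (fun n => Posz (reflection_complexity x n)).
Proof.
move=> n; exists [seq inord d | d <- rep U n].
  rewrite /digits -map_comp -[RHS]map_id; apply/eq_in_map => d.
  by move=> /(allP (rep_lt hU adderP n)) lt_d /=; rewrite inordK.
set w := map _ _; have Dw : digits w = rep U n.
  rewrite /digits -map_comp -[RHS]map_id; apply/eq_in_map => d.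
  by move=> /(allP (rep_lt hU adderP n)) lt_d /=; rewrite inordK.
rewrite lr_value_cnt //; last by move=> *; rewrite ltn_mod.
  (* By [len_first_occ], words of this length cover all first occurrences, and it is the length of n
     behind [D] zeros. *)
  congr Posz; rewrite Dw (cntE k_gt1); pose t := D + len U n.
  have lt_n : n < U t by rewrite -(len_leq hU) leq_addl.
  have Dn : nseq D 0 ++ rep U n = greedy U t n.
    by rewrite (greedy_pad hU lt_n) /pad size_rep addnK.
  rewrite Dn size_greedy.
  rewrite -(@sum_first_occ _ x n (U t)) => [|i fi]; last first.
    rewrite -(len_leq hU) /t addnC; exact: (len_first_occ hU greedy_k recog_D).
  transitivity (\sum_(0 <= i < U t) first_occ x n (wval U (greedy U t i))).
    by apply: eq_big_nat => i /= lt_i; rewrite wval_greedy.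
  rewrite -(sum_valid hU k_gt1 greedy_k t (fun y => first_occ x n (wval U y))).
  apply: eq_big_nat => y /= lt_y.
  rewrite -[tab_acc _ _ _ _]/(tab_run D k' z _ _) tab_runP ?size_greedy ?greedy_k //.
    by rewrite /occ_lang valid_greedy // wval_greedy //; case: (valid _ _); rewrite ?mul1n ?mul0n.
  exact: greedy_expn_lt.
by rewrite ltn_mod.
Qed.

Lemma code_rowE q :
  code_row U M c q = count_row k D (tab_init D k' z) (tab_delta D k' z) q.
Proof.
rewrite /code_row /count_row DE; apply: eq_bigr => w _; congr (nat_of_bool (_ == _)).
rewrite (prec_mkseq (fun y d => tab_delta D k' z y 0 d)) /run2 greedyE.
have Dz (s : seq nat) : zip (nseq (size s) 0) s = [seq (0, d) | d <- s].
  by elim: s => //= d s ->.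
rewrite -[D in nseq D _](size_mkseq (greedy_digit (expn k) D w)) Dz.
by elim: (mkseq _ _) (tab_init D k' z) => //= d s IHs q0; rewrite IHs.
Qed.

Lemma code_linrepE : code_linrep U M c = linrep_code occ_linrep.
Proof.
rewrite /linrep_code.
have -> : mx_code (lr_row occ_linrep) =
    mkseq (fun l => 2 * code_row U M c (l %% D)) (1 * D).
  rewrite (mx_codeE 1 D (fun _ q => count_row k D (tab_init D k' z) (tab_delta D k' z) q)).
  by apply: eq_map => l; rewrite code_rowE.
have -> : mx_code (lr_col occ_linrep) =
    mkseq (fun l => 2 * tab_acc D k' z (l %/ 1)) (D * 1).
  exact: (mx_codeE D 1 (fun q _ => tab_acc D k' z q)).
have -> : flatten [seq mx_code (lr_mx occ_linrep d) | d <- enum 'I_k] =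
    mkseq (fun l => 2 * code_mx U M c (l %/ (D * D)) (l %% (D * D) %/ D)
      (l %% (D * D) %% D)) (k * (D * D)).
  rewrite -(flatten_mkseq (fun d l => 2 * code_mx U M c d (l %/ D) (l %% D))).
  rewrite -map_enum_ord; congr flatten; apply: eq_map => d.
  rewrite (mx_codeE D D (fun p q => count_mx k (tab_delta D k' z) d p q)).
  by apply: eq_map => l; rewrite /code_mx DE.
rewrite /code_linrep DE -[X in code_cat _ (D * 1) X]/(CodeSeq.code [::]).
by rewrite !code_catE cats0 /= -!mul2n.
Qed.

End Correctness.

Theorem theorem8p1 (U : nat -> nat) (hU : numeration_system U)
    (hadd : has_adder U) :
  (forall (T : finType) (x : nat -> T), automatic U x ->
     regular U (fun n : nat => Posz (reflection_complexity x n))) /\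
  (exists F : nat -> nat, computable F /\
     forall (T : finType) (x : nat -> T) (k : nat) (M : dfao 'I_k T),
       generates U M x ->
       exists (l : nat) (L : linrep l),
         represents U L (fun n : nat => Posz (reflection_complexity x n)) /\
         F (dfao_code M) = linrep_code L).
Proof.
have [[|k'] [M adderP]] := hadd.
  (* An adder over an empty alphabet would read only the empty word, but the triple for 1 + 0 = 1 is
     nonempty. *)
  have [_ [|w]] := adderP (pad3 (rep U 1) (rep U 0) (rep U 1)); first by exists 1, 0, 1.
  case: w => [|[[[]]]] // /(congr1 size); rewrite rep0 // /pad3 maxn0 maxnn.
  rewrite !size_zip !size_pad // !minnn size_rep => /esym/eqP.
  by rewrite -leqn0 (len_leq hU) U0.
split=> [T x [K [A Ax]] |].
  exists k'.+1, (occ_linrep hU adderP (erefl (code_dim M (dfao_code A)))).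
  exact: occ_linrep_represents.
exists (code_linrep U M); split; first exact: computable_code_linrep.
move=> T x K A Ax; exists k'.+1, (occ_linrep hU adderP (erefl (code_dim M (dfao_code A)))); split.
  exact: occ_linrep_represents.
exact: code_linrepE.
Qed.
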